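(* Let $V$ be an at most countable index set, and consider any symmetric, stochastic matrix $P=\{P(x,y)\}_{x,y\in V}$. Suppose that $\Gamma\le \mathsf{Aut}(P)$ is a closed, unimodular subgroup which acts transitively on $V$, and let $G=(V,E)$ be any graph on which $\Gamma$ acts by automorphisms. If $\mathsf{dist}$ is the path metric on $G$, and $\psi\in\ell^2(V)$, then for every time $t$, $$\mathbb{E}\left[\mathsf{dist}(X_0,X_t)^2\right]\ \ge\ p_*\,\frac{\langle\psi,(I-P^t)\psi\rangle}{\langle\psi,(I-P)\psi\rangle}\ \ge\ p_*\left(t-t^2\,\frac{\|(I-P)\psi\|^2}{2\langle\psi,(I-P)\psi\rangle}\right),$$ where $\{X_t\}$ denotes the random walk with transition kernel $P$ started at any $X_0=x_0\in V$, and $$p_*=\min\{P(x,y):\{x,y\}\in E\}.$$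
   Context: $\mathsf{Aut}(P)$ is the group of all bijections $\sigma:V\to V$ with $P(\sigma x,\sigma y)=P(x,y)$ for all $x,y\in V$, with the topology of pointwise convergence on the discrete set $V$. Unimodular means that $\Gamma$ has a Haar measure that is both left- and right-invariant. ''$\Gamma$ acts on $G=(V,E)$ by automorphisms'' means that each $\sigma\in\Gamma$, acting on the vertex set $V$, preserves $E$. $P$ acts on $\ell^2(V)$ by $(Pf)(x)=\sum_y P(x,y)f(y)$; inner products and norms are those of $\ell^2(V)$. Time $t$ is a nonnegative integer. *)

(* Defs.v *)
From HB Require Import structures.
From mathcomp Require Import all_boot all_order all_algebra.
From mathcomp Require Import all_classical all_reals all_analysis.

Set Implicit Arguments.
Unset Strict Implicit.
Unset Printing Implicit Defensive.

Import Order.TTheory GRing.Theory Num.Theory.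

Local Open Scope classical_set_scope.
Local Open Scope ring_scope.

(* A group carrying a topology. The topological-group axioms are not bundled:
   the only groups used below are permutation groups with the topology of
   pointwise convergence, for which they are theorems. *)
#[short(type="groupTopologicalType")]
HB.structure Definition GroupTopological :=
  {T of Group T & Topological T & Pointed T}.

Section haar.
Context (R : realType) (T : groupTopologicalType).

Definition borel := g_sigma_algebraType (@open T).

Definition radon (mu : {measure set borel -> \bar R}) : Prop :=
  [/\ forall K : set T, compact K -> (mu K < +oo)%E,
      forall A : set borel, measurable A ->
        mu A = ereal_inf [set mu U | U in [set U : set T | open U /\ A `<=` U]]
    & forall U : set T, open U ->
        mu U = ereal_sup [set mu K | K in [set K : set T | compact K /\ K `<=` U]]].

Definition left_invariant (mu : {measure set borel -> \bar R}) : Prop :=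
  forall (g : T) (A : set borel), measurable A ->
    mu [set (g * h)%g | h in A] = mu A.

Definition right_invariant (mu : {measure set borel -> \bar R}) : Prop :=
  forall (g : T) (A : set borel), measurable A ->
    mu [set (h * g)%g | h in A] = mu A.

Definition haar (mu : {measure set borel -> \bar R}) : Prop :=
  [/\ radon mu, mu [set: borel] != 0%E & left_invariant mu].

Definition unimodular : Prop :=
  exists mu : {measure set borel -> \bar R}, haar mu /\ right_invariant mu.

End haar.

Section automorphisms.
Context (R : realType) (V : countType) (P : V -> V -> R).

Record Aut := MkAut {
  aut_fun :> V -> V ;
  aut_bij : bijective aut_fun ;
  aut_P : forall x y, P (aut_fun x) (aut_fun y) = P x y }.

Lemma aut_ext (s u : Aut) : s =1 u -> s = u.
Proof.
case: s u => [s sb sP] [u ub uP] /= /funext su; subst u.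
by rewrite (Prop_irrelevance sb ub) (Prop_irrelevance sP uP).
Qed.

HB.instance Definition _ := gen_eqMixin Aut.
HB.instance Definition _ := gen_choiceMixin Aut.

Definition aut_one : Aut :=
  @MkAut id (Bijective (fun=> erefl) (fun=> erefl)) (fun _ _ => erefl).

Fact aut_mulP (s u : Aut) x y : P (s (u x)) (s (u y)) = P x y.
Proof. by rewrite !aut_P. Qed.

Definition aut_mul (s u : Aut) : Aut :=
  @MkAut (s \o u) (bij_comp (aut_bij s) (aut_bij u)) (aut_mulP s u).

Fact aut_inv_subproof (s : Aut) : exists u : Aut, cancel s u /\ cancel u s.
Proof.
have [u su us] := aut_bij s.
have uP x y : P (u x) (u y) = P x y by rewrite -(aut_P s) !us.
by exists (MkAut (Bijective us su) uP).
Qed.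

Definition aut_inv (s : Aut) : Aut := projT1 (cid (aut_inv_subproof s)).

Fact aut_mulA : associative aut_mul.
Proof. by move=> s u v; apply: aut_ext. Qed.

Fact aut_mul1s : left_id aut_one aut_mul.
Proof. by move=> s; apply: aut_ext. Qed.

Fact aut_muls1 : right_id aut_one aut_mul.
Proof. by move=> s; apply: aut_ext. Qed.

Fact aut_mulVs : left_inverse aut_one aut_inv aut_mul.
Proof.
move=> s; apply: aut_ext => x /=; rewrite /aut_inv.
by case: cid => u /= [+ _]; apply.
Qed.

Fact aut_mulsV : right_inverse aut_one aut_inv aut_mul.
Proof.
move=> s; apply: aut_ext => x /=; rewrite /aut_inv.
by case: cid => u /= [_ +]; apply.
Qed.

HB.instance Definition _ :=
  isGroup.Build Aut aut_mulA aut_mul1s aut_muls1 aut_mulVs aut_mulsV.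

HB.instance Definition _ := isPointed.Build Aut aut_one.

HB.instance Definition _ := Topological.copy Aut
  (initial_topology (aut_fun : Aut -> {ptws V -> discrete_topology V})).

Section subgroup.
Variable Gamma : groupClosed Aut.

Definition subgroup := {s : Aut | s \in Gamma}.

HB.instance Definition _ := SubChoice.on subgroup.

Fact subgroup_closed : group_closed Gamma.
Proof. by split=> [|s u sG uG]; rewrite ?gpred1// gpredM ?gpredVr. Qed.

HB.instance Definition _ :=
  SubChoice_isSubGroup.Build Aut (mem Gamma) subgroup subgroup_closed.

HB.instance Definition _ := isPointed.Build subgroup 1%g.

HB.instance Definition _ := Topological.copy subgroup
  (initial_topology (val : subgroup -> Aut)).

End subgroup.

End automorphisms.

Section l2.
Context (R : realType) (V : countType).
Implicit Types f g : V -> R.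

(* The sum of an absolutely summable real family; esum is only meant for
   nonnegative terms. *)
Definition rsum f : R :=
  fine (\esum_(x in [set: V]) (EFin \o f)^\+ x
        - \esum_(x in [set: V]) (EFin \o f)^\- x)%E.

Definition in_l2 f : Prop := summable [set: V] (fun x => (f x ^+ 2)%:E).

Definition l2dot f g : R := rsum (fun x => f x * g x).

Definition l2norm f : R := Num.sqrt (l2dot f f).

Definition markov_op (P : V -> V -> R) f : V -> R :=
  fun x => rsum (fun y => P x y * f y).

Definition stochastic (P : V -> V -> R) : Prop :=
  (forall x y, 0 <= P x y) /\
  (forall x, \esum_(y in [set: V]) (P x y)%:E = 1%E).

End l2.

Section walk.
Context (R : realType) (V : countType) (P : V -> V -> R) (x0 : V).
Context (d : measure_display) (Omega : measurableType d).
Context (Pr : probability Omega R).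

(* The Markov property is stated without conditioning:
   Pr(X_0 = v_0, .., X_(n+1) = v_(n+1))
     = Pr(X_0 = v_0, .., X_n = v_n) * P(v_n, v_(n+1)). *)
Definition random_walk (X : nat -> Omega -> V) : Prop :=
  [/\ forall n v, measurable (X n @^-1` [set v]),
      Pr (X 0%N @^-1` [set x0]) = 1%E
    & forall (n : nat) (v : nat -> V),
        Pr [set w | forall i, (i <= n.+1)%N -> X i w = v i] =
        (Pr [set w | forall i, (i <= n)%N -> X i w = v i]
           * (P (v n) (v n.+1))%:E)%E].

End walk.

Section graph.
Context (R : realType) (V : countType) (E : rel V).

(* The path metric; it is +oo between distinct connected components. *)
Definition gdist (x y : V) : \bar R :=
  ereal_inf [set ((size p)%:R)%:E | p in [set p | path E x p /\ last x p = y]].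

(* As an infimum this is defined for every graph, and it is the minimum
   whenever the minimum is attained. *)
Definition pstar (P : V -> V -> R) : \bar R :=
  ereal_inf [set (P e.1 e.2)%:E | e in [set e : V * V | E e.1 e.2]].

End graph.

(* Main.v *)
(* Write N(x,y) for the number of points in the orbit of y under the
   stabilizer of x; it is finite when the walk can go from x to y, because the
   transition probability is constant on that orbit. Put
     q(x,y) = 1/N(x,y) * sum of (psi u - psi v)^2 over (u,v) in Gamma(x,y).
   Regrouping the pairs (u,v) into diagonal orbits gives
     sum_y P^t(x,y) q(x,y) = 2 <psi, (I - P^t) psi>,
   so q <= 2 <psi, (I - P) psi> / p_* on edges.
   If N(x,y) = N(y,x) on all edges, counting orbits of triples shows that
   sqrt q satisfies the triangle inequality, hence
   q(x,y) <= dist(x,y)^2 * 2 <psi, (I - P) psi> / p_*, which is the claim.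
   Otherwise the height h(x,y) = ln (N(x,y) / N(y,x)) is a nontrivial additive
   cocycle, so that h(X_0,X_t) is a sum of t independent identically
   distributed steps. If l is the supremum of |h| over the edges, then
   |h| <= l dist, and a step takes each of two opposite values close to l and
   -l with probability at least p_*; so E dist^2 >= Var h(X_0,X_t) / l^2
   >= t p_*, and the ratio in the theorem is at most t.
   The lower bound on the ratio is the telescoping identity
   <psi, P^i (I-P) psi> - <psi, P^(i+1) (I-P) psi>
     = <(I-P) psi, P^i (I-P) psi>. *)
Require Import Defs.
From HB Require Import structures.
From mathcomp Require Import all_boot all_order all_algebra.
From mathcomp Require Import all_classical all_reals all_analysis.
From mathcomp Require Import measurable_realfun.
From mathcomp Require Import ring lra.

Set Implicit Arguments.
Unset Strict Implicit.
Unset Printing Implicit Defensive.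

Import Order.TTheory GRing.Theory Num.Theory.

Local Open Scope classical_set_scope.
Local Open Scope ring_scope.

(** * Sums over countable types *)

Local Notation "\esum_ x F" := (esum [set: _] (fun x => F%E))
  (at level 41, x name, F at level 41).

Section nonneg_sums.
Local Open Scope ereal_scope.
Context {R : realType}.

(** Finite partial sums give one inequality; the other is the same inequality for the factor [c^-1]
    and the family [c f], so [c = 0] is treated apart. *)
Lemma esumZl {T : choiceType} (c : R) (f : T -> \bar R) :
  (0 <= c)%R -> (forall x, 0 <= f x) ->
  \esum_ x (c%:E * f x) = c%:E * \esum_ x f x.
Proof.
have le (k : R) (g : T -> \bar R) : (0 <= k)%R -> (forall x, 0 <= g x) ->
    \esum_ x (k%:E * g x) <= k%:E * \esum_ x g x.
  move=> k0 g0; apply: ge_ereal_sup => _ [A [finA _] <-].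
  rewrite -ge0_mule_fsumr//; apply: lee_pmul => //; first by rewrite fsume_ge0.
  by apply: ereal_sup_ubound; exists A.
move=> c0 f0; apply/eqP; rewrite eq_le le//=.
have [->|cn0] := eqVneq c 0%R.
  by rewrite mul0e esum_ge0// => x _; rewrite mul0e.
have ci : (c * c^-1 = 1)%R by rewrite mulfV.
have -> : \esum_ x f x = \esum_ x (c^-1%:E * (c%:E * f x)).
  by apply: eq_esum => x _; rewrite muleA -EFinM mulrC ci mul1e.
apply: (@le_trans _ _ (c%:E * (c^-1%:E * \esum_ x (c%:E * f x)))).
  apply: lee_pmul => //; first by apply: esum_ge0 => x _; rewrite !mule_ge0 ?lee_fin ?invr_ge0.
  by apply: le => [|x]; rewrite ?invr_ge0// mule_ge0.
by rewrite muleA -EFinM ci mul1e.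
Qed.

Lemma esumZr {T : choiceType} (c : R) (f : T -> \bar R) :
  (0 <= c)%R -> (forall x, 0 <= f x) ->
  \esum_ x (f x * c%:E) = (\esum_ x f x) * c%:E.
Proof.
by move=> c0 f0; rewrite muleC -esumZl//; apply: eq_esum => x _; rewrite muleC.
Qed.

Lemma esum_exchange {T U : choiceType} (f : T -> U -> \bar R) :
  (forall x y, 0 <= f x y) ->
  \esum_ x \esum_ y f x y = \esum_ y \esum_ x f x y.
Proof.
move=> f0; rewrite !esum_esum//.
rewrite (reindex_esum ([set: U] `*`` (fun=> [set: T])) _
  (fun p : U * T => (p.2, p.1)))//.
split=> //= [[a b] [c e] _ _ /= [-> ->]//|[a b] _]; by exists (b, a).
Qed.

Lemma esum_reindex {T : choiceType} (e : T -> T) (f : T -> \bar R) :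
  bijective e -> \esum_ x f (e x) = \esum_ x f x.
Proof.
move=> [e' ee' e'e]; rewrite [RHS](reindex_esum [set: T] _ e)//.
split=> // [x y _ _|x _]; first exact: (can_inj ee').
by exists (e' x).
Qed.

Lemma le_esum_term {T : choiceType} (x : T) (f : T -> \bar R) :
  (forall y, 0 <= f y) -> f x <= \esum_ y f y.
Proof.
move=> f0; rewrite -(esum_set1 (f0 x)); apply: ge_ereal_sup => _ [A [fA _] <-].
by apply: ereal_sup_ubound; exists A.
Qed.

Lemma esum_single {T : choiceType} (x : T) (f : T -> \bar R) :
  0 <= f x -> (forall y, y <> x -> f y = 0) -> \esum_ y f y = f x.
Proof.
move=> fx0 f0; rewrite -(esum_set1 fx0) [RHS]esum_mkcond; apply: eq_esum => y _.
by case: ifPn => // /negP yx; apply: f0 => e; apply: yx; rewrite inE.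
Qed.

Lemma le_esum_two {T : choiceType} (x y : T) (f : T -> \bar R) : x != y ->
  (forall z, 0 <= f z) -> f x + f y <= \esum_ z f z.
Proof.
move=> xy f0.
have E (w : T) : f w = \esum_ z (if z == w then f z else 0).
  by rewrite (@esum_single _ w) ?eqxx// => z /eqP/negbTE ->.
rewrite (E x) (E y) -esumD => [|z _|z _]; [|by case: ifP..].
apply: le_esum => z _; case: eqVneq => [->|_]; last by case: ifP; rewrite add0e.
by rewrite (negbTE xy) adde0.
Qed.

Lemma esum_comb {T : choiceType} (a b : R) (f g : T -> \bar R) :
  (0 <= a)%R -> (0 <= b)%R -> (forall x, 0 <= f x) -> (forall x, 0 <= g x) ->
  \esum_ x (a%:E * f x + b%:E * g x) = a%:E * (\esum_ x f x) + b%:E * (\esum_ x g x).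
Proof.
by move=> a0 b0 f0 g0; rewrite esumD ?esumZl// => x _; rewrite mule_ge0 ?lee_fin.
Qed.

End nonneg_sums.

(** * Absolutely summable real families *)

Section real_sums.
Context {R : realType}.

Definition summ {T : countType} (f : T -> R) : Prop :=
  (\esum_ x `|f x|%:E < +oo)%E.

Lemma summ_le {T : countType} (f g : T -> R) :
  summ g -> (forall x, `|f x| <= g x) -> summ f.
Proof.
move=> sg fg; apply: le_lt_trans sg; apply: le_esum => x _; rewrite lee_fin.
exact: le_trans (fg x) (ler_norm _).
Qed.

Lemma summE {T : countType} (f : T -> R) : (forall x, 0 <= f x) ->
  summ f = (\esum_ x (f x)%:E < +oo)%E.
Proof.
by move=> f0; congr (_ < _)%E; apply: eq_esum => x _; rewrite ger0_norm.
Qed.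

Lemma summD {T : countType} (f g : T -> R) :
  summ f -> summ g -> summ (fun x => f x + g x).
Proof.
move=> sf sg; rewrite /summ.
apply: le_lt_trans (_ : (\esum_ x (`|f x|%:E + `|g x|%:E) < +oo)%E).
  by apply: le_esum => x _; rewrite -EFinD lee_fin ler_normD.
by rewrite esumD// lte_add_pinfty.
Qed.

Lemma summZ {T : countType} c (f : T -> R) : summ f -> summ (fun x => c * f x).
Proof.
move=> sf; rewrite /summ (_ : esum _ _ = `|c|%:E * \esum_ x `|f x|%:E)%E.
  by rewrite lte_mul_pinfty// lee_fin.
by rewrite -esumZl//; apply: eq_esum => x _; rewrite normrM EFinM.
Qed.

Lemma summN {T : countType} (f : T -> R) : summ f -> summ (fun x => - f x).
Proof. by apply: le_lt_trans; apply: le_esum => x _; rewrite normrN. Qed.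

Lemma fine_esumK {T : countType} (f : T -> R) : (forall x, 0 <= f x) -> summ f ->
  (fine (\esum_ x (f x)%:E))%:E = \esum_ x (f x)%:E.
Proof.
move=> f0; rewrite summE// => fo; rewrite fineK// ge0_fin_numE//.
by apply: esum_ge0 => x _; rewrite lee_fin.
Qed.

(** Any splitting into nonnegative summable families computes [rsum], not only the canonical one;
    linearity then reduces to choosing a convenient splitting. *)
Lemma rsum_diff {T : countType} (f a b : T -> R) :
  (forall x, 0 <= a x) -> (forall x, 0 <= b x) -> summ a -> summ b ->
  (forall x, f x = a x - b x) ->
  rsum f = fine (\esum_ x (a x)%:E) - fine (\esum_ x (b x)%:E).
Proof.
move=> a0 b0 sa sb fab; rewrite /rsum.
have -> : EFin \o f = ((EFin \o a) \- (EFin \o b))%E.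
  by apply/funext => x /=; rewrite fab EFinB.
rewrite esumB//; last 2 first.
- by move=> x _; rewrite lee_fin.
- by move=> x _; rewrite lee_fin.
by rewrite -(fine_esumK a0 sa) -(fine_esumK b0 sb) -EFinB.
Qed.

Lemma rsum_ge0E {T : countType} (f : T -> R) : (forall x, 0 <= f x) -> summ f ->
  (rsum f)%:E = \esum_ x (f x)%:E.
Proof.
move=> f0 sf; rewrite (@rsum_diff _ f f (fun=> 0))//.
- by rewrite [X in _ - fine X]esum1// subr0 fine_esumK.
- by rewrite summE// esum1.
- by move=> x; rewrite subr0.
Qed.

Definition ppart (r : R) := Num.max r 0.
Definition npart (r : R) := Num.max (- r) 0.

Lemma ppart_ge0 r : 0 <= ppart r. Proof. by rewrite le_max lexx orbT. Qed.
Lemma npart_ge0 r : 0 <= npart r. Proof. by rewrite le_max lexx orbT. Qed.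
Hint Resolve ppart_ge0 npart_ge0 : core.

Lemma pnpartB r : r = ppart r - npart r.
Proof. by rewrite /ppart /npart /Num.max; do 2 case: ltP => ?; lra. Qed.

Lemma ppart_le r : ppart r <= `|r|.
Proof. by rewrite ge_max ler_norm normr_ge0. Qed.

Lemma npart_le r : npart r <= `|r|.
Proof. by rewrite ge_max -normrN ler_norm normr_ge0. Qed.

Lemma summ_ppart {T : countType} (f : T -> R) : summ f -> summ (ppart \o f).
Proof.
by apply: le_lt_trans; apply: le_esum => x _; rewrite lee_fin ger0_norm//= ppart_le.
Qed.

Lemma summ_npart {T : countType} (f : T -> R) : summ f -> summ (npart \o f).
Proof.
by apply: le_lt_trans; apply: le_esum => x _; rewrite lee_fin ger0_norm//= npart_le.
Qed.

Lemma rsumE {T : countType} (f : T -> R) : summ f ->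
  rsum f = fine (\esum_ x (ppart (f x))%:E) - fine (\esum_ x (npart (f x))%:E).
Proof.
move=> sf; apply: rsum_diff => // [||x]; last exact: pnpartB.
- exact: summ_ppart.
- exact: summ_npart.
Qed.

Lemma rsumD {T : countType} (f g : T -> R) : summ f -> summ g ->
  rsum (fun x => f x + g x) = rsum f + rsum g.
Proof.
move=> sf sg.
rewrite (@rsum_diff _ _ (fun x => ppart (f x) + ppart (g x))
                        (fun x => npart (f x) + npart (g x))).
- rewrite (rsumE sf) (rsumE sg).
  have D (a b : T -> R) : (forall x, 0 <= a x) -> (forall x, 0 <= b x) ->
    summ a -> summ b -> fine (\esum_ x (a x + b x)%:E) =
      fine (\esum_ x (a x)%:E) + fine (\esum_ x (b x)%:E).
    move=> a0 b0 sa sb; rewrite (_ : esum _ _ = \esum_ x ((a x)%:E + (b x)%:E))//.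
    rewrite esumD; [|by move=> x _; rewrite lee_fin..].
    by rewrite -(fine_esumK a0 sa) -(fine_esumK b0 sb) -EFinD.
  have p0 h x : 0 <= (ppart \o h) x :> R by exact: ppart_ge0.
  have n0 h x : 0 <= (npart \o h) x :> R by exact: npart_ge0.
  rewrite (D _ _ (p0 T f) (p0 T g) (summ_ppart sf) (summ_ppart sg)).
  rewrite (D _ _ (n0 T f) (n0 T g) (summ_npart sf) (summ_npart sg)).
  by rewrite opprD addrACA.
- by move=> x; rewrite addr_ge0.
- by move=> x; rewrite addr_ge0.
- by apply: summD; exact: summ_ppart.
- by apply: summD; exact: summ_npart.
- by move=> x; rewrite {1}(pnpartB (f x)) {1}(pnpartB (g x)); lra.
Qed.

Lemma rsumN {T : countType} (f : T -> R) : summ f ->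
  rsum (fun x => - f x) = - rsum f.
Proof.
move=> sf; rewrite (rsumE sf) opprB.
apply: rsum_diff => // [||x]; [exact: summ_npart|exact: summ_ppart|].
by rewrite {1}(pnpartB (f x)); lra.
Qed.

Lemma rsumZ {T : countType} c (f : T -> R) : summ f ->
  rsum (fun x => c * f x) = c * rsum f.
Proof.
move=> sf; wlog c0 : c / 0 <= c => [hw|].
  have [/hw//|c0] := leP 0 c.
  rewrite (_ : (fun x => _) = fun x => - ((- c) * f x)); last first.
    by apply/funext => x; lra.
  by rewrite rsumN ?hw//; [lra|lra|exact: summZ].
rewrite (@rsum_diff _ _ (fun x => c * ppart (f x)) (fun x => c * npart (f x))).
- rewrite (rsumE sf) mulrBr.
  have Z (a : T -> R) : (forall x, 0 <= a x) -> summ a ->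
      fine (\esum_ x (c * a x)%:E) = c * fine (\esum_ x (a x)%:E).
    move=> a0 sa; under eq_esum do rewrite EFinM.
    rewrite esumZl//.
    by rewrite -(fine_esumK a0 sa) -EFinM.
  have p0 x : 0 <= (ppart \o f) x by exact: ppart_ge0.
  have n0 x : 0 <= (npart \o f) x by exact: npart_ge0.
  by rewrite (Z _ p0 (summ_ppart sf)) (Z _ n0 (summ_npart sf)).
- by move=> x; rewrite mulr_ge0.
- by move=> x; rewrite mulr_ge0.
- exact/summZ/summ_ppart.
- exact/summZ/summ_npart.
- by move=> x; rewrite -mulrBr -pnpartB.
Qed.

Lemma rsumB {T : countType} (f g : T -> R) : summ f -> summ g ->
  rsum (fun x => f x - g x) = rsum f - rsum g.
Proof. by move=> sf sg; rewrite -rsumN// -rsumD//; exact: summN. Qed.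

Lemma rsum_ge0 {T : countType} (f : T -> R) : (forall x, 0 <= f x) ->
  summ f -> 0 <= rsum f.
Proof.
by move=> f0 sf; rewrite -lee_fin rsum_ge0E//; apply: esum_ge0 => x _; rewrite lee_fin.
Qed.

Lemma eq_rsum {T : countType} (f g : T -> R) : f =1 g -> rsum f = rsum g.
Proof. by move=> /funext ->. Qed.

(** Fubini: each iterated sum is a difference of two nonnegative double sums, and those may be
    exchanged freely. *)
Lemma rsum_exchange {T U : countType} (f : T -> U -> R) :
  (\esum_ x \esum_ y `|f x y|%:E < +oo)%E ->
  rsum (fun x => rsum (fun y => f x y)) = rsum (fun y => rsum (fun x => f x y)).
Proof.
move=> sf.
have side (W Z : countType) (g : W -> Z -> R) :
    (\esum_ x \esum_ y `|g x y|%:E < +oo)%E ->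
    rsum (fun x => rsum (g x)) = fine (\esum_ x \esum_ y (ppart (g x y))%:E)
                               - fine (\esum_ x \esum_ y (npart (g x y))%:E).
  move=> sg.
  have sgx x : summ (g x).
    apply: le_lt_trans sg; apply: (@le_esum_term _ _ x (fun x => \esum_ y `|g x y|%:E)%E).
    by move=> z; apply: esum_ge0.
  (* Stated for a general [h] so as to serve both [ppart] and [npart]. *)
  have pos (h : R -> R) : (forall r, 0 <= h r) -> (forall r, h r <= `|r|) ->
      (forall x, (fine (\esum_ y (h (g x y))%:E))%:E = \esum_ y (h (g x y))%:E) /\
      summ (fun x => fine (\esum_ y (h (g x y))%:E)).
    move=> h0 hle.
    have E x : (fine (\esum_ y (h (g x y))%:E))%:E = \esum_ y (h (g x y))%:E.
      apply: fine_esumK => //; apply: le_lt_trans (sgx x); apply: le_esum => y _.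
      by rewrite lee_fin ger0_norm.
    split=> //; rewrite summE; last first.
      by move=> x; rewrite -lee_fin E; apply: esum_ge0 => y _; rewrite lee_fin.
    apply: le_lt_trans sg; apply: le_esum => x _; rewrite E; apply: le_esum => y _.
    by rewrite lee_fin.
  have [Ep sp] := pos _ ppart_ge0 ppart_le.
  have [En sn] := pos _ npart_ge0 npart_le.
  rewrite (@rsum_diff _ _ _ _ _ _ sp sn).
  - by rewrite (eq_esum (fun x _ => Ep x)) (eq_esum (fun x _ => En x)).
  - by move=> x; rewrite -lee_fin Ep; apply: esum_ge0 => y _; rewrite lee_fin.
  - by move=> x; rewrite -lee_fin En; apply: esum_ge0 => y _; rewrite lee_fin.
  - by move=> x; exact: rsumE.
rewrite side; last exact: sf.
rewrite side; last by rewrite esum_exchange.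
have E (h : R -> R) : (forall r, 0 <= h r) ->
    \esum_ x \esum_ y (h (f x y))%:E = \esum_ y \esum_ x (h (f x y))%:E.
  by move=> h0; apply: esum_exchange => x y; rewrite lee_fin.
by rewrite (E _ ppart_ge0) (E _ npart_ge0).
Qed.

End real_sums.
#[local] Hint Resolve ppart_ge0 npart_ge0 : core.

(** * Symmetric stochastic kernels on l2 *)

Section l2_theory.
Context {R : realType} {V : countType}.
Implicit Types f g : V -> R.

Lemma l2E f : in_l2 f = summ (fun x => f x ^+ 2). Proof. by []. Qed.

Lemma l2_mul f g : in_l2 f -> in_l2 g -> summ (fun x => f x * g x).
Proof.
rewrite !l2E => lf lg; apply: summ_le (summD lf lg) _ => x.
rewrite ler_norml; apply/andP; split.
  by have := sqr_ge0 (f x + g x); have := sqr_ge0 (f x); have := sqr_ge0 (g x); rewrite !expr2; lra.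
by have := sqr_ge0 (f x - g x); have := sqr_ge0 (f x); have := sqr_ge0 (g x); rewrite !expr2; lra.
Qed.

Lemma l2B f g : in_l2 f -> in_l2 g -> in_l2 (f \- g).
Proof.
rewrite !l2E => lf lg.
apply: summ_le (summD (summZ 2 lf) (summZ 2 lg)) _ => x.
by rewrite ger0_norm ?sqr_ge0//; have := sqr_ge0 (f x + g x); rewrite /= !expr2; lra.
Qed.

Lemma l2dotC f g : l2dot f g = l2dot g f.
Proof. by apply: eq_rsum => x; rewrite mulrC. Qed.

Lemma l2dotBr f g h : in_l2 f -> in_l2 g -> in_l2 h ->
  l2dot f (g \- h) = l2dot f g - l2dot f h.
Proof.
move=> lf lg lh; rewrite -rsumB; [|exact: l2_mul..].
by apply: eq_rsum => x; rewrite /= mulrBr.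
Qed.

Lemma l2dot_ge0 f : in_l2 f -> 0 <= l2dot f f.
Proof.
move=> lf; apply: rsum_ge0 => [x|]; first by rewrite -expr2 sqr_ge0.
exact: l2_mul.
Qed.

Lemma l2norm_sqr f : in_l2 f -> l2norm f ^+ 2 = l2dot f f.
Proof. by move=> lf; rewrite sqr_sqrtr// l2dot_ge0. Qed.

Section kernel.
Variable Q : V -> V -> R.
Hypothesis symQ : forall x y, Q x y = Q y x.
Hypothesis stoQ : stochastic Q.

Lemma ker_ge0 x y : 0 <= Q x y. Proof. by case: stoQ. Qed.

Lemma ker_sqr_ge0 x y r : 0 <= Q x y * r ^+ 2.
Proof. by rewrite mulr_ge0// ?ker_ge0 ?sqr_ge0. Qed.

Lemma ker_sum1 x : \esum_ y (Q x y)%:E = 1%E. Proof. by case: stoQ. Qed.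

Lemma ker_le1 x y : Q x y <= 1.
Proof.
rewrite -lee_fin -(ker_sum1 x); apply: le_esum_term (fun y => (Q x y)%:E) _ => z.
by rewrite lee_fin ker_ge0.
Qed.

Lemma ker_summ x : summ (Q x).
Proof. by rewrite summE; [rewrite ker_sum1 ltry|exact: ker_ge0]. Qed.

Lemma rsum_ker x : rsum (Q x) = 1.
Proof. by apply: EFin_inj; rewrite rsum_ge0E ?ker_sum1//; [exact: ker_ge0|exact: ker_summ]. Qed.

Lemma ker_row_sqr_summ x f : in_l2 f -> summ (fun y => Q x y * f y ^+ 2).
Proof.
move=> lf; apply: summ_le lf _ => y; rewrite ger0_norm ?ker_sqr_ge0//.
by rewrite ler_piMl ?sqr_ge0 ?ker_le1.
Qed.

(** The bound [|f| <= 1 + f^2] reduces this to the row sum and to the weighted sum of squares. *)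
Lemma ker_row_summ x f : in_l2 f -> summ (fun y => Q x y * f y).
Proof.
move=> lf; apply: summ_le (summD (ker_summ x) (ker_row_sqr_summ x lf)) _ => y.
rewrite normrM (ger0_norm (ker_ge0 x y)) -[X in X + _]mulr1 -mulrDr.
rewrite ler_wpM2l ?ker_ge0// -[f y ^+ 2]real_normK ?num_real//.
by have := sqr_ge0 (`|f y| - 1); have := normr_ge0 (f y); rewrite !expr2; nra.
Qed.

(** By symmetry the columns of [Q] also sum to 1, that is, counting measure is invariant. *)
Lemma ker_sqr_esum f : in_l2 f ->
  \esum_ x \esum_ y (Q x y * f y ^+ 2)%:E = \esum_ y (f y ^+ 2)%:E.
Proof.
move=> lf; rewrite esum_exchange => [|x y]; last first.
  by rewrite lee_fin ker_sqr_ge0.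
apply: eq_esum => y _; under eq_esum do rewrite EFinM.
rewrite esumZr; [|exact: sqr_ge0|by move=> x; rewrite lee_fin ker_ge0].
by under eq_esum do rewrite symQ; rewrite ker_sum1 mul1e.
Qed.

(** Jensen's inequality, from the nonnegativity of the variance of [f] under the law [Q x]. *)
Lemma markov_sqr_le x f : in_l2 f ->
  markov_op Q f x ^+ 2 <= rsum (fun y => Q x y * f y ^+ 2).
Proof.
move=> lf; set m := markov_op Q f x.
have s1 := ker_summ x; have s2 := ker_row_summ x lf; have s3 := ker_row_sqr_summ x lf.
have E : rsum (fun y => Q x y * (f y - m) ^+ 2) =
    rsum (fun y => Q x y * f y ^+ 2) - 2 * m * m + m ^+ 2.
  transitivity (rsum (fun y => (Q x y * f y ^+ 2 + (- (2 * m)) * (Q x y * f y))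
    + m ^+ 2 * Q x y)); first by apply: eq_rsum => y; ring.
  rewrite rsumD; [|by apply: summD => //; exact: summZ|exact: summZ].
  rewrite rsumD//; last exact: summZ.
  by rewrite !rsumZ// rsum_ker -/(markov_op Q f x) -/m; ring.
have : 0 <= rsum (fun y => Q x y * (f y - m) ^+ 2).
  apply: rsum_ge0 => [y|]; first by exact: ker_sqr_ge0.
  rewrite (_ : (fun y => _) = fun y => (Q x y * f y ^+ 2 + (- (2 * m)) * (Q x y * f y))
    + m ^+ 2 * Q x y); last by apply/funext => y; ring.
  by apply: summD; [apply: summD => //; exact: summZ|exact: summZ].
by rewrite E; lra.
Qed.

Lemma ker_sqr_rsum_esum f x : in_l2 f ->
  (rsum (fun y => Q x y * f y ^+ 2))%:E = \esum_ y (Q x y * f y ^+ 2)%:E.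
Proof.
move=> lf; apply: rsum_ge0E; last exact: ker_row_sqr_summ.
by move=> y; exact: ker_sqr_ge0.
Qed.

Lemma ker_sqr_rsum_ge0 f x : in_l2 f -> 0 <= rsum (fun y => Q x y * f y ^+ 2).
Proof.
move=> lf; apply: rsum_ge0; last exact: ker_row_sqr_summ.
by move=> y; exact: ker_sqr_ge0.
Qed.

Lemma ker_sqr_summ f : in_l2 f -> summ (fun x => rsum (fun y => Q x y * f y ^+ 2)).
Proof.
move=> lf; rewrite summE => [|x]; last exact: ker_sqr_rsum_ge0.
rewrite (eq_esum (fun x _ => ker_sqr_rsum_esum x lf)) ker_sqr_esum//.
by move: lf; rewrite l2E summE// => x; exact: sqr_ge0.
Qed.

Lemma markov_l2 f : in_l2 f -> in_l2 (markov_op Q f).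
Proof.
move=> lf; apply: summ_le (ker_sqr_summ lf) _ => x.
by rewrite ger0_norm ?sqr_ge0// markov_sqr_le.
Qed.

Lemma iter_markov_l2 f n : in_l2 f -> in_l2 (iter n (markov_op Q) f).
Proof. by move=> lf; elim: n => //= n IH; exact: markov_l2. Qed.

Lemma markovB f g : in_l2 f -> in_l2 g ->
  markov_op Q (f \- g) = markov_op Q f \- markov_op Q g.
Proof.
move=> lf lg; apply/funext => x; rewrite /markov_op /= -rsumB; [|exact: ker_row_summ..].
by apply: eq_rsum => y; rewrite mulrBr.
Qed.

Lemma iter_markovB f g n : in_l2 f -> in_l2 g ->
  iter n (markov_op Q) (f \- g) = iter n (markov_op Q) f \- iter n (markov_op Q) g.
Proof.
by move=> lf lg; elim: n => //= n ->; rewrite markovB//; exact: iter_markov_l2.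
Qed.

(** Absolute convergence for the exchange of sums behind self-adjointness:
    [|f x * g y| <= f x ^2 + g y ^2], and each square sums to a squared norm. *)
Lemma ker_form_summ f g : in_l2 f -> in_l2 g ->
  (\esum_ x \esum_ y `|f x * (Q x y * g y)|%:E < +oo)%E.
Proof.
move=> lf lg.
apply: (@le_lt_trans _ _ (\esum_ x \esum_ y ((Q y x * f x ^+ 2)%:E + (Q x y * g y ^+ 2)%:E))).
  apply: le_esum => x _; apply: le_esum => y _.
  rewrite -EFinD lee_fin mulrCA normrM (ger0_norm (ker_ge0 x y)) (symQ y x) -mulrDr.
  rewrite ler_wpM2l ?ker_ge0// ler_norml; apply/andP; split.
    by have := sqr_ge0 (f x + g y); have := sqr_ge0 (f x); have := sqr_ge0 (g y);
      rewrite !expr2; lra.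
  by have := sqr_ge0 (f x - g y); have := sqr_ge0 (f x); have := sqr_ge0 (g y);
      rewrite !expr2; lra.
have n0 (h : V -> R) x y : (0 <= (Q x y * h y ^+ 2)%:E)%E.
  by rewrite lee_fin ker_sqr_ge0.
have -> : \esum_ x \esum_ y ((Q y x * f x ^+ 2)%:E + (Q x y * g y ^+ 2)%:E) =
   (\esum_ x \esum_ y (Q y x * f x ^+ 2)%:E + \esum_ x \esum_ y (Q x y * g y ^+ 2)%:E)%E.
  rewrite -esumD; [|by move=> x _; apply: esum_ge0..].
  by apply: eq_esum => x _; rewrite esumD.
rewrite ker_sqr_esum// esum_exchange// ker_sqr_esum//.
have fin (h : V -> R) : in_l2 h -> (\esum_ y (h y ^+ 2)%:E < +oo)%E.
  by rewrite l2E summE// => x; exact: sqr_ge0.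
by rewrite lte_add_pinfty ?fin.
Qed.

Lemma l2dot_markov f g : in_l2 f -> in_l2 g ->
  l2dot f (markov_op Q g) = l2dot (markov_op Q f) g.
Proof.
move=> lf lg.
have -> : l2dot f (markov_op Q g) = rsum (fun x => rsum (fun y => f x * (Q x y * g y))).
  by apply: eq_rsum => x; rewrite rsumZ//; exact: ker_row_summ.
rewrite rsum_exchange; last exact: ker_form_summ.
apply: eq_rsum => y; rewrite mulrC /markov_op -rsumZ; last exact: ker_row_summ.
by apply: eq_rsum => x; rewrite (symQ x y); ring.
Qed.

Lemma l2dot_iter_markov f g n : in_l2 f -> in_l2 g ->
  l2dot f (iter n (markov_op Q) g) = l2dot (iter n (markov_op Q) f) g.
Proof.
move=> lf lg; elim: n f lf => //= n IH f lf.
rewrite l2dot_markov//; last exact: iter_markov_l2.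
by rewrite IH -?iterSr//; exact: markov_l2.
Qed.

(* Both signs are needed: the minus sign gives the Dirichlet form, the plus
   sign the lower bound [-1] on the spectrum. *)
Lemma markov_form (s : R) f : s ^+ 2 = 1 -> in_l2 f ->
  (2 * (l2dot f f - s * l2dot f (markov_op Q f)))%:E =
  \esum_ u \esum_ v (Q u v * (f u - s * f v) ^+ 2)%:E.
Proof.
move=> s1 lf.
pose A u := rsum (fun v => Q u v * f v ^+ 2).
pose B u := f u ^+ 2 + A u + (- 2 * s) * (f u * markov_op Q f u).
have sr u : summ (fun v => Q u v * (f u - s * f v) ^+ 2) /\
    rsum (fun v => Q u v * (f u - s * f v) ^+ 2) = B u.
  have -> : (fun v => Q u v * (f u - s * f v) ^+ 2) = fun v =>
      f u ^+ 2 * Q u v + Q u v * f v ^+ 2 + (- 2 * s * f u) * (Q u v * f v).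
    by apply/funext => v; rewrite sqrrB exprMn s1; ring.
  have S1 := summZ (f u ^+ 2) (ker_summ u).
  have S2 := ker_row_sqr_summ u lf.
  have S3 := summZ (-2 * s * f u) (ker_row_summ u lf).
  split; first by apply: summD => //; exact: summD.
  rewrite rsumD//; last exact: summD.
  rewrite rsumD// (rsumZ _ (ker_summ u)) (rsumZ _ (ker_row_summ u lf)) rsum_ker.
  by rewrite /B /A /markov_op; ring.
have n0 u v : 0 <= Q u v * (f u - s * f v) ^+ 2.
  by exact: ker_sqr_ge0.
have -> : \esum_ u \esum_ v (Q u v * (f u - s * f v) ^+ 2)%:E = \esum_ u (B u)%:E.
  by apply: eq_esum => u _; rewrite -rsum_ge0E//; [rewrite (sr u).2|exact: (sr u).1].
have B0 u : 0 <= B u by rewrite -(sr u).2; apply: rsum_ge0 => //; exact: (sr u).1.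
have sA := ker_sqr_summ lf.
have sfm := l2_mul lf (markov_l2 lf).
have sB : summ B by apply: summD; [exact: summD|exact: summZ].
rewrite -rsum_ge0E//; congr (_%:E).
rewrite /B rsumD; [|exact: summD|exact: summZ].
rewrite (rsumD lf sA) (rsumZ _ sfm).
have -> : rsum A = l2dot f f.
  apply: EFin_inj; rewrite rsum_ge0E//; last by move=> u; exact: ker_sqr_rsum_ge0.
  rewrite (eq_esum (fun x _ => ker_sqr_rsum_esum x lf)) ker_sqr_esum//.
  by rewrite -rsum_ge0E//= => x; exact: sqr_ge0.
have -> : rsum (fun x => f x ^+ 2) = l2dot f f by [].
by rewrite /l2dot; ring.
Qed.

Lemma markov_form_ge0 (s : R) f : s ^+ 2 = 1 -> in_l2 f ->
  0 <= l2dot f f - s * l2dot f (markov_op Q f).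
Proof.
move=> s1 lf; rewrite -(@pmulr_rge0 _ 2)// -lee_fin markov_form//.
by do 2![apply: esum_ge0 => ? _]; rewrite lee_fin ker_sqr_ge0.
Qed.

End kernel.
End l2_theory.

(** * Powers of the kernel and the Dirichlet form *)

Section powers.
Context {R : realType} {V : countType}.
Variable P : V -> V -> R.
Hypothesis symP : forall x y, P x y = P y x.
Hypothesis stoP : stochastic P.

Definition delta (y : V) : V -> R := fun z => (z == y)%:R.

(** The [n]-step transition probability, read off from the operator on point masses, so that its
    symmetry is self-adjointness of the operator. *)
Definition kpow n x y := iter n (markov_op P) (delta y) x.

Lemma esum_delta (y : V) (f : V -> R) : (forall x, 0 <= f x) ->
  \esum_ x (delta y x * f x)%:E = (f y)%:E.
Proof.
move=> f0; rewrite (@esum_single _ _ y).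
- by rewrite /delta eqxx mul1r.
- by rewrite lee_fin mulr_ge0 ?ler0n.
- by move=> x /eqP/negbTE; rewrite /delta => ->; rewrite mul0r.
Qed.

Lemma delta_l2 y : in_l2 (delta y).
Proof.
rewrite l2E summE => [|x]; last exact: sqr_ge0.
have <- : \esum_ x (delta y x * 1)%:E = \esum_ x (delta y x ^+ 2)%:E.
  by apply: eq_esum => x _; rewrite /delta; case: eqP; rewrite ?mul0r ?mul1r ?expr0n ?expr1n.
by rewrite esum_delta// ltry.
Qed.

Lemma l2dot_delta y f : in_l2 f -> l2dot (delta y) f = f y.
Proof.
move=> lf; rewrite /l2dot (@rsum_diff _ _ _ (fun x => delta y x * ppart (f x))
  (fun x => delta y x * npart (f x))).
- by rewrite !esum_delta//= -?pnpartB.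
- by move=> x; rewrite mulr_ge0 ?ler0n ?ppart_ge0.
- by move=> x; rewrite mulr_ge0 ?ler0n ?npart_ge0.
- rewrite summE ?esum_delta ?ltry// => x.
  by rewrite mulr_ge0 ?ler0n ?ppart_ge0.
- rewrite summE ?esum_delta ?ltry// => x.
  by rewrite mulr_ge0 ?ler0n ?npart_ge0.
- by move=> x; rewrite -mulrBr -pnpartB.
Qed.

Lemma kpow_l2 n y : in_l2 (iter n (markov_op P) (delta y)).
Proof. exact/iter_markov_l2/delta_l2. Qed.

Lemma kpow0 x y : kpow 0 x y = (x == y)%:R. Proof. by []. Qed.

Lemma kpow_sym n x y : kpow n x y = kpow n y x.
Proof.
rewrite /kpow -l2dot_delta; last exact: kpow_l2.
rewrite l2dot_iter_markov//; [|exact: delta_l2..].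
by rewrite l2dotC l2dot_delta//; exact: kpow_l2.
Qed.

Lemma kpow_ge0 n x y : 0 <= kpow n x y.
Proof.
elim: n x => [|n IH] x; first by rewrite kpow0 ler0n.
apply: rsum_ge0 => [z|]; first by rewrite mulr_ge0 ?(ker_ge0 stoP)//; exact: IH.
by apply: ker_row_summ => //; exact: kpow_l2.
Qed.

Lemma kpowS n x y : (kpow n.+1 x y)%:E = \esum_ z ((P x z)%:E * (kpow n z y)%:E).
Proof.
rewrite {1}/kpow /= /markov_op rsum_ge0E.
- by apply: eq_esum => z _; rewrite EFinM.
- by move=> z; rewrite mulr_ge0 ?(ker_ge0 stoP)//; exact: kpow_ge0.
- by apply: ker_row_summ => //; exact: kpow_l2.
Qed.

Lemma kpowSr n x y : (kpow n.+1 x y)%:E = \esum_ z ((kpow n x z)%:E * (P z y)%:E).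
Proof.
rewrite kpow_sym kpowS; apply: eq_esum => z _.
by rewrite muleC (kpow_sym n z x) symP.
Qed.

Lemma kpow1 x y : kpow 1 x y = P x y.
Proof.
apply: EFin_inj; rewrite kpowS (@esum_single _ _ y) => [||z /eqP/negbTE].
- by rewrite kpow0 eqxx mule1.
- by rewrite mule_ge0 ?lee_fin ?(ker_ge0 stoP) ?kpow_ge0.
- by rewrite kpow0 => ->; rewrite mule0.
Qed.

Lemma kpow_stochastic n : stochastic (kpow n).
Proof.
split; first exact: kpow_ge0.
elim: n => [|n IH] x.
  rewrite (@esum_single _ _ x) ?kpow0 ?eqxx// => y /eqP yx.
  by rewrite kpow0 eq_sym (negbTE yx).
under eq_esum do rewrite kpowS.
have k0 z y : (0 <= (P x z)%:E * (kpow n z y)%:E)%E.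
  by rewrite mule_ge0 ?lee_fin ?(ker_ge0 stoP) ?kpow_ge0.
rewrite esum_exchange// -[RHS](ker_sum1 stoP x); apply: eq_esum => z _.
rewrite esumZl ?IH ?mule1 ?(ker_ge0 stoP)// => y.
by rewrite lee_fin kpow_ge0.
Qed.

(** Identifies the iterated operator with the operator of a symmetric stochastic kernel, so that the
    results for a general [Q] apply to it. *)
Lemma markov_kpow n f : in_l2 f -> markov_op (kpow n) f = iter n (markov_op P) f.
Proof.
move=> lf; apply/funext => x.
transitivity (l2dot (iter n (markov_op P) (delta x)) f).
  by apply: eq_rsum => y; rewrite (kpow_sym n x y).
rewrite -l2dot_iter_markov//; last exact: delta_l2.
by rewrite l2dot_delta//; exact: iter_markov_l2.
Qed.

Lemma kpow_invariant (s : V -> V) n : bijective s ->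
  (forall x y, P (s x) (s y) = P x y) ->
  forall x y, kpow n (s x) (s y) = kpow n x y.
Proof.
move=> sb sP; elim: n => [|n IH] x y.
  by rewrite !kpow0 (inj_eq (bij_inj sb)).
apply: EFin_inj; rewrite !kpowS.
rewrite -(esum_reindex (fun z => (P (s x) z)%:E * (kpow n z (s y))%:E)%E sb).
by apply: eq_esum => z _; rewrite sP IH.
Qed.

Variable psi : V -> R.
Hypothesis lpsi : in_l2 psi.

(** The value [a i] will be the increment of [dirichlet] from [i] to [i.+1], and [c i] the decrement
    of [a] from [i] to [i.+1]; both bounds on [dirichlet] come from these differences. *)
Let chi := psi \- markov_op P psi.
Let a i := l2dot psi (iter i (markov_op P) chi).
Let c i := l2dot chi (iter i (markov_op P) chi).
Definition dirichlet t := l2dot psi (psi \- iter t (markov_op P) psi).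

Let lPpsi : in_l2 (markov_op P psi). Proof. exact: markov_l2. Qed.
Let lchi : in_l2 chi. Proof. exact: l2B. Qed.
Let liter t f : in_l2 f -> in_l2 (iter t (markov_op P) f).
Proof. exact: iter_markov_l2. Qed.

Lemma dirichlet0 : dirichlet 0 = 0.
Proof. by rewrite /dirichlet l2dotBr// subrr. Qed.

Let dirichletS t : dirichlet t.+1 = dirichlet t + a t.
Proof.
rewrite /dirichlet /a /chi iter_markovB// !l2dotBr//; do ?exact: liter.
by rewrite -iterSr; lra.
Qed.

Lemma dirichlet_esum t : (2 * dirichlet t)%:E =
  \esum_ u \esum_ v (kpow t u v * (psi u - psi v) ^+ 2)%:E.
Proof.
have := markov_form (kpow_sym t) (kpow_stochastic t) (expr1n _ 2) lpsi.
rewrite markov_kpow// mul1r /dirichlet l2dotBr//; last exact: liter.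
by move=> ->; apply: eq_esum => u _; apply: eq_esum => v _; rewrite mul1r.
Qed.

Lemma dirichlet_ge0 t : 0 <= dirichlet t.
Proof.
have := markov_form_ge0 (kpow_sym t) (kpow_stochastic t) (expr1n _ 2) lpsi.
by rewrite markov_kpow// mul1r /dirichlet l2dotBr//; exact: liter.
Qed.

Let aS i : a i.+1 = a i - c i.
Proof.
rewrite /a /c /= l2dot_markov//; last exact: liter.
rewrite [c in _ - c]l2dotC /chi.
rewrite l2dotBr//; [|exact/liter..].
by rewrite l2dotC (l2dotC psi) opprB addrC subrK l2dotC.
Qed.

(** The difference is [<chi, (I - P^i) chi>], a Dirichlet form of the kernel [kpow i]. *)
Let c_le0 i : c i <= c 0%N.
Proof.
have := markov_form_ge0 (kpow_sym i) (kpow_stochastic i) (expr1n _ 2) lchi.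
by rewrite markov_kpow// mul1r subr_ge0.
Qed.

Let c_even k : c k.*2 = l2dot (iter k (markov_op P) chi) (iter k (markov_op P) chi).
Proof. by rewrite /c -addnn iterD l2dot_iter_markov//; exact: liter. Qed.

Let c_odd k : c k.*2.+1 =
  l2dot (iter k (markov_op P) chi) (markov_op P (iter k (markov_op P) chi)).
Proof.
by rewrite /c -addnn -addnS iterD l2dot_iter_markov//; exact/(liter k.+1).
Qed.

Let c_even_ge0 k : 0 <= c k.*2.
Proof. by rewrite c_even l2dot_ge0//; exact: liter. Qed.

(** With [phi = P^k chi] the sum is [<phi, (I + P) phi>], which is the form with sign [-1]. *)
Let c_pair_ge0 k : 0 <= c k.*2 + c k.*2.+1.
Proof.
have n1 : (- 1) ^+ 2 = 1 :> R by rewrite sqrrN expr1n.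
have := markov_form_ge0 symP stoP n1 (liter k lchi).
by rewrite c_even c_odd; lra.
Qed.

Lemma dirichlet_lower t :
  t%:R * dirichlet 1 - t%:R ^+ 2 * (l2norm chi ^+ 2 / 2) <= dirichlet t.
Proof.
rewrite l2norm_sqr// -/(c 0%N); set C := c 0%N.
have C0 : 0 <= C by exact: (c_even_ge0 0).
have d1 : dirichlet 1 = a 0%N by rewrite dirichletS dirichlet0 add0r.
have al i : dirichlet 1 - i%:R * C <= a i.
  elim: i => [|i IH]; first by rewrite mul0r d1; lra.
  by rewrite aS -natr1; have := c_le0 i; rewrite -/C; lra.
elim: t => [|t IH]; first by rewrite dirichlet0 expr0n/= !mul0r; lra.
(* Summing [i * C] over [i < t] gives [t (t - 1) / 2 * C]; replacing it by [t^2 / 2 * C] leaves a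
   slack of [C / 2] per step. *)
have step (T e D A B : R) : T * e - T ^+ 2 * (B / 2) <= D -> e - T * B <= A -> 0 <= B ->
    (T + 1) * e - (T + 1) ^+ 2 * (B / 2) <= D + A by nra.
by rewrite (dirichletS t) -(natr1 t); exact: step IH (al t) C0.
Qed.

(* The spectrum of [P] lies in [-1, 1], hence [I - P^t <= t (I - P)]. *)
Lemma dirichlet_upper t : dirichlet t <= t%:R * dirichlet 1.
Proof.
have d1 : dirichlet 1 = a 0%N by rewrite dirichletS dirichlet0 add0r.
have al i : a i <= a 0%N.
  (* The decrement [c i] may be negative for odd [i], so [a] is compared with itself two steps
     earlier, and each odd index with the even index before it. *)
  have [ev od] : a i./2.*2 <= a 0%N /\ a i./2.*2.+1 <= a 0%N.
    elim: i./2 => [|k [IH1 IH2]]; first by rewrite aS; have := c_even_ge0 0; lra.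
    have E : a k.+1.*2 = a k.*2 - (c k.*2 + c k.*2.+1) by rewrite doubleS !aS; lra.
    have := c_pair_ge0 k; have := c_even_ge0 k.+1.
    by rewrite (aS k.+1.*2) E; lra.
  by rewrite -[i]odd_double_half; case: (odd i); rewrite ?add0n ?add1n.
elim: t => [|t IH]; first by rewrite dirichlet0 mul0r.
by rewrite (dirichletS t) -(natr1 t) mulrDl mul1r lerD// d1.
Qed.

End powers.

(** * The law of the walk *)

Section countable_partition.
Context {R : realType} {d : measure_display} {T : measurableType d} {W : countType}.
Variables (mu : {measure set T -> \bar R}) (g : T -> W).
Hypothesis mg : forall y, measurable (g @^-1` [set y]).

Lemma integral_fibers (f : T -> \bar R) :
  measurable_fun [set: T] f -> (forall x, (0 <= f x)%E) ->
  (\int[mu]_x f x)%E = \esum_ y (\int[mu]_(x in g @^-1` [set y]) f x).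
Proof.
move=> mf f0.
(* Countable additivity is indexed by [nat], so the fibers are listed by their codes; a number that
   codes nothing contributes the empty set. *)
pose F n := if pickle_inv n is Some y then g @^-1` [set y] else set0.
have FE : \bigcup_n F n = [set: T].
  apply/seteqP; split=> // x _; exists (pickle (g x)) => //.
  by rewrite /F pickleK_inv.
have mF n : measurable (F n) by rewrite /F; case: pickle_inv.
have tF : trivIset [set: nat] F.
  move=> i j _ _ [x []]; rewrite /F.
  case Ei : (pickle_inv i) => [y|//]; case Ej : (pickle_inv j) => [z|//] /= yE zE.
  move: (@pickle_invK W i) (@pickle_invK W j); rewrite Ei Ej /= => <- <-.
  by rewrite -yE -zE.
rewrite -FE ge0_integral_bigcup//; last by rewrite FE.
rewrite nneseries_esumT; last by move=> n; exact: integral_ge0.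
pose a n := (\int[mu]_(x in F n) f x)%E.
transitivity (\esum_(n in pickle @` [set: W]) a n).
  rewrite [RHS]esum_mkcond; apply: eq_esum => n _.
  case: ifPn => // /negP nW; rewrite /F.
  case En : (pickle_inv n) => [y|]; last exact: integral_set0.
  exfalso; apply: nW; rewrite inE; exists y => //.
  by move: (@pickle_invK W n); rewrite En.
rewrite esum_image; last by move=> x y _ _; exact: (pcan_inj (@pickleK _)).
by apply: eq_esum => y _; rewrite /a /F pickleK_inv.
Qed.

Lemma measure_fibers (A : set T) : measurable A ->
  mu A = \esum_ y (mu (A `&` g @^-1` [set y])).
Proof.
move=> mA; rewrite -[A in LHS]setIT -integral_indic// integral_fibers.
- by apply: eq_esum => y _; rewrite integral_indic.
- by apply/measurable_EFinP; exact: measurable_indic.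
- by move=> x; rewrite lee_fin.
Qed.

(** Every preimage is a countable union of fibers of [g], whatever [f] is. *)
Lemma measurable_countable_comp {d' : measure_display} {U : measurableType d'}
  (f : W -> U) : measurable_fun [set: T] (f \o g).
Proof.
move=> _ B mB; rewrite setTI.
rewrite (_ : _ @^-1` B = \bigcup_(y : W) (if `[< B (f y) >] then g @^-1` [set y] else set0)).
  apply: countable_bigcupT_measurable => [|y]; first exact: countableP.
  by case: ifP.
apply/seteqP; split=> [x /= Bx|x [y _]].
  by exists (g x) => //; rewrite asboolT.
by case: ifPn => // /asboolP By /= ->.
Qed.

End countable_partition.

Section walk_law.
Context {R : realType} {V : countType}.
Variable P : V -> V -> R.
Hypothesis symP : forall x y, P x y = P y x.
Hypothesis stoP : stochastic P.
Variables (x0 : V) (d : measure_display) (Omega : measurableType d).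
Variables (Pr : probability Omega R) (X : nat -> Omega -> V).
Hypothesis walkX : random_walk P x0 Pr X.

Let mX n v : measurable (X n @^-1` [set v]). Proof. by case: walkX. Qed.

Let start : Pr (X 0%N @^-1` [set x0]) = 1%E. Proof. by case: walkX. Qed.

(** The walk starts at [x0] only almost surely; this lets any event be cut down to the outcomes that
    do start there. *)
Lemma walk_start_ae (A : set Omega) : measurable A ->
  Pr (A `&` X 0%N @^-1` [set x0]) = Pr A.
Proof.
move=> mA; apply/eqP; rewrite eq_le; apply/andP; split.
  by apply: le_measure; rewrite ?inE//; exact: measurableI.
rewrite -{1}(setUIDK A (X 0%N @^-1` [set x0])).
apply: le_trans (measureU2 _ _ _) _; [exact: measurableI|exact: measurableD|].
rewrite [X in (_ + X)%E](_ : _ = 0%E) ?adde0//.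
apply/eqP; rewrite eq_le measure_ge0 andbT.
apply: le_trans (_ : Pr (~` (X 0%N @^-1` [set x0])) <= _)%E.
  by apply: le_measure; rewrite ?inE//; by [exact: measurableD|exact: measurableC|move=> x []].
by rewrite probability_setC// start subee.
Qed.

(** The history is encoded as a list because lists over [V] form a countable type, so that events
    can be split along it. *)
Definition prefix n w : seq V := [seq X i w | i <- iota 0 n.+1].

Lemma prefix_fiber n s : size s = n.+1 ->
  prefix n @^-1` [set s] = [set w | forall i, (i <= n)%N -> X i w = nth x0 s i].
Proof.
move=> ss; apply/seteqP; split=> w /= E.
  move=> i iN; rewrite -E /prefix (nth_map 0%N) ?size_iota// nth_iota//.
apply: (@eq_from_nth _ x0); first by rewrite size_map size_iota.
move=> i; rewrite size_map size_iota => iN.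
by rewrite (nth_map 0%N) ?size_iota// nth_iota// E.
Qed.

Lemma prefix_fiber0 n s : size s != n.+1 -> prefix n @^-1` [set s] = set0.
Proof.
move=> ss; apply/seteqP; split=> // w /= E; move: ss.
by rewrite -E size_map size_iota eqxx.
Qed.

Lemma measurable_prefix n s : measurable (prefix n @^-1` [set s]).
Proof.
have [ss|ss] := eqVneq (size s) n.+1; last by rewrite prefix_fiber0.
rewrite prefix_fiber// (_ : mkset _ =
  \bigcap_(i in [set i | (i <= n)%N]) X i @^-1` [set nth x0 s i])//.
by apply: bigcap_measurableType => i _; exact: mX.
Qed.

Lemma prefix_step n s y :
  Pr (X n.+1 @^-1` [set y] `&` prefix n @^-1` [set s]) =
  (Pr (prefix n @^-1` [set s]) * (P (last x0 s) y)%:E)%E.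
Proof.
have [ss|ss] := eqVneq (size s) n.+1; last by rewrite prefix_fiber0// setI0 measure0 mul0e.
(* The Markov property takes an infinite sequence; beyond index [n.+1] this one has the default
   value [x0], which no event below reads. *)
pose v i := nth x0 (rcons s y) i.
have vl i : (i <= n)%N -> v i = nth x0 s i by move=> iN; rewrite /v nth_rcons ss ltnS iN.
have [_ _ /(_ n v)] := walkX.
have -> : v n = last x0 s by rewrite vl// (last_nth x0) ss.
have -> : v n.+1 = y by rewrite /v nth_rcons ss ltnn eqxx.
rewrite prefix_fiber//.
have <- : [set w | forall i, (i <= n)%N -> X i w = v i] =
          [set w | forall i, (i <= n)%N -> X i w = nth x0 s i].
  by apply/seteqP; split=> w /= H i iN; rewrite H// vl.
move=> <-; congr (Pr _); apply/seteqP; split=> w /=.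
  move=> [Xy H] i; rewrite leq_eqVlt => /orP[/eqP ->|]; last exact: H.
  by rewrite Xy /v nth_rcons ss ltnn eqxx.
move=> H; split; last by move=> i iN; apply: H; exact: leqW.
by rewrite H// /v nth_rcons ss ltnn eqxx.
Qed.

(** The Markov property speaks of whole histories, so the event is split by history and then
    regrouped by the vertex [z] occupied at time [n]. *)
Lemma walk_law n y : Pr (X n @^-1` [set y]) = (kpow P n x0 y)%:E.
Proof.
elim: n y => [|n IH] y.
  rewrite kpow0; case: eqVneq => [<-//|yx].
  rewrite -walk_start_ae// (_ : _ `&` _ = set0) ?measure0//.
  by apply/seteqP; split=> // w [/= Ey Ex]; move: yx; rewrite -Ey -Ex eqxx.
rewrite kpowSr//.
rewrite (measure_fibers _ (measurable_prefix n))//.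
(* For a given history only the term [z = last x0 s] is possibly nonzero. *)
have E s : Pr (X n.+1 @^-1` [set y] `&` prefix n @^-1` [set s]) =
    \esum_ z (Pr (X n @^-1` [set z] `&` prefix n @^-1` [set s]) * (P z y)%:E).
  rewrite prefix_step (@esum_single _ _ (last x0 s)).
  - have [ss|ss] := eqVneq (size s) n.+1; last by rewrite prefix_fiber0// setI0.
    congr (Pr _ * _)%E; apply/seteqP; split=> w /=; last by case.
    by move=> <-; split=> //; rewrite /prefix -addn1 iotaD map_cat last_cat.
  - by rewrite mule_ge0// lee_fin (ker_ge0 stoP).
  - move=> z zs; rewrite (_ : _ `&` _ = set0) ?measure0 ?mul0e//.
    apply/seteqP; split=> // w [/= Xz E]; apply: zs.
    by rewrite -E /prefix -addn1 iotaD map_cat last_cat.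
rewrite (eq_esum (fun s _ => E s)) esum_exchange; last first.
  by move=> s z; rewrite mule_ge0// lee_fin (ker_ge0 stoP).
apply: eq_esum => z _; rewrite esumZr ?(ker_ge0 stoP)//.
by rewrite -IH (measure_fibers Pr (measurable_prefix n) (mX n z)).
Qed.

(** Only a lower bound is sought, so each fiber of [X n] may be shrunk to the event of starting at
    [x0], which has the same probability and on which the integrand is constant. *)
Lemma walk_expectation n (F : V -> V -> \bar R) : (forall x y, (0 <= F x y)%E) ->
  (\esum_ y ((kpow P n x0 y)%:E * F x0 y) <= \int[Pr]_w F (X 0%N w) (X n w))%E.
Proof.
move=> F0.
have mf : measurable_fun [set: Omega] (fun w => F (X 0%N w) (X n w)).
  have mXX (v : V * V) : measurable ((fun w => (X 0%N w, X n w)) @^-1` [set v]).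
    rewrite (_ : _ @^-1` _ = X 0%N @^-1` [set v.1] `&` X n @^-1` [set v.2]).
      exact: measurableI.
    by case: v => a b; apply/seteqP; split=> w /= [-> ->].
  exact: (measurable_countable_comp mXX (fun v => F v.1 v.2)).
rewrite (@integral_fibers _ _ _ _ Pr (X n))//; apply: le_esum => y _.
have mA : measurable (X n @^-1` [set y] `&` X 0%N @^-1` [set x0]) by exact: measurableI.
rewrite -walk_law -walk_start_ae// muleC -integral_cst//.
apply: (@le_trans _ _ (\int[Pr]_(w in X n @^-1` [set y] `&` X 0%N @^-1` [set x0])
    F (X 0%N w) (X n w))%E).
  by rewrite (eq_integral (fun w => F (X 0%N w) (X n w)))// => w; rewrite inE => -[/= -> ->].
by apply: ge0_subset_integral => //; exact: measurable_funS mf.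
Qed.

End walk_law.

(** * Diagonal orbits of a transitive permutation group *)

Section orbits.
Context {R : realType} {V : countType}.
Variable G : set (V -> V).
Hypothesis G1 : G id.
Hypothesis GM : forall s u, G s -> G u -> G (s \o u).
Hypothesis GV : forall s, G s -> exists u, [/\ G u, cancel s u & cancel u s].
Hypothesis Gtrans : forall x y, exists2 s, G s & s x = y.

(** Indicators of diagonal orbits, real-valued so that counting becomes summation and an infinite
    orbit gets length [+oo]. *)
Definition orb2 (x y u v : V) : R := `[< exists2 s, G s & s x = u /\ s y = v >]%:R.
Definition orb3 (x y z u v w : V) : R :=
  `[< exists2 s, G s & [/\ s x = u, s y = v & s z = w] >]%:R.

(* [orbsize x y] is the length of the orbit of [y] under the stabilizer of
   [x]; [orbsize3 x y z] that of [z] under the stabilizer of [x] and [y]. *)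
Definition orbsize x y : \bar R := \esum_ v (orb2 x y x v)%:E.
Definition orbsize3 x y z : \bar R := \esum_ w (orb3 x y z x y w)%:E.

Lemma orb2_ge0 x y u v : 0 <= orb2 x y u v. Proof. exact: ler0n. Qed.
Lemma orb3_ge0 x y z u v w : 0 <= orb3 x y z u v w. Proof. exact: ler0n. Qed.

Lemma G_bij s : G s -> bijective s.
Proof. by move=> /GV[u [_ su us]]; exists u. Qed.

Lemma orb2_move s x y u v : G s -> orb2 x y (s u) (s v) = orb2 x y u v.
Proof.
move=> Gs; congr (_%:R); congr nat_of_bool; apply/asboolP/asboolP => -[r Gr [rx ry]].
  have [s' [Gs' ss' _]] := GV Gs.
  by exists (s' \o r); [exact: GM|rewrite /= rx ry !ss'].
by exists (s \o r); [exact: GM|rewrite /= rx ry].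
Qed.

Lemma orb2_source s x y u v : G s -> orb2 (s x) (s y) u v = orb2 x y u v.
Proof.
move=> Gs; congr (_%:R); congr nat_of_bool; apply/asboolP/asboolP => -[r Gr [rx ry]].
  by exists (r \o s); [exact: GM|].
have [s' [Gs' ss' _]] := GV Gs.
by exists (r \o s'); [exact: GM|rewrite /= !ss'].
Qed.

Lemma orb3_move s x y z u v w : G s ->
  orb3 x y z (s u) (s v) (s w) = orb3 x y z u v w.
Proof.
move=> Gs; congr (_%:R); congr nat_of_bool; apply/asboolP/asboolP => -[r Gr [rx ry rz]].
  have [s' [Gs' ss' _]] := GV Gs.
  by exists (s' \o r); [exact: GM|rewrite /= rx ry rz !ss'].
by exists (s \o r); [exact: GM|rewrite /= rx ry rz].
Qed.

Lemma orb3_perm12 x y z u v w : orb3 x y z u v w = orb3 y x z v u w.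
Proof.
congr (_%:R); congr nat_of_bool.
by apply/asboolP/asboolP => -[r Gr [? ? ?]]; exists r.
Qed.

Lemma orb3_perm23 x y z u v w : orb3 x y z u v w = orb3 x z y u w v.
Proof.
congr (_%:R); congr nat_of_bool.
by apply/asboolP/asboolP => -[r Gr [? ? ?]]; exists r.
Qed.

Lemma orb2_swap x y u v : orb2 x y u v = orb2 u v x y.
Proof.
have sub a b a' b' : (exists2 s, G s & s a = a' /\ s b = b') ->
    exists2 s, G s & s a' = a /\ s b' = b.
  move=> [s Gs [<- <-]]; have [s' [Gs' ss' _]] := GV Gs.
  by exists s' => //; rewrite !ss'.
by congr (_%:R); congr nat_of_bool; apply/asboolP/asboolP; exact: sub.
Qed.

Lemma orb2_id x y : orb2 x y x y = 1.
Proof. by rewrite /orb2 asboolT//; exists id. Qed.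

Lemma orb3_id x y z : orb3 x y z x y z = 1.
Proof. by rewrite /orb3 asboolT//; exists id. Qed.

Lemma orb3_le2 x y z u v w : orb3 x y z u v w <= orb2 x z u w.
Proof.
rewrite /orb3 /orb2; case: asboolP => [[r Gr [rx _ rz]]|_]; last by rewrite ler0n.
by rewrite asboolT//; exists r.
Qed.

(** By transitivity the section of the orbit over any [u] is a translate of the section over [x]. *)
Lemma esum_orb2 x y u : \esum_ v (orb2 x y u v)%:E = orbsize x y.
Proof.
have [s Gs <-] := Gtrans x u.
rewrite -(esum_reindex _ (G_bij Gs)); apply: eq_esum => v _.
by rewrite orb2_move.
Qed.

(** The section of the triple orbit over [(u, v)] is a translate of the one over [(x, y)], or
    empty. *)
Lemma esum_orb3 x y z u v :
  \esum_ w (orb3 x y z u v w)%:E = (orbsize3 x y z * (orb2 x y u v)%:E)%E.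
Proof.
rewrite /orb2; case: asboolP => [[s Gs [<- <-]]|n].
  rewrite mule1 -(esum_reindex _ (G_bij Gs)); apply: eq_esum => w _.
  by rewrite orb3_move.
rewrite mule0 esum1// => w _; rewrite /orb3 asboolF// => -[s Gs [su sv _]].
by apply: n; exists s.
Qed.

Lemma orbsize_move s x y : G s -> orbsize (s x) (s y) = orbsize x y.
Proof.
move=> Gs; rewrite -[RHS](esum_orb2 _ _ (s x)); apply: eq_esum => v _.
by rewrite orb2_source.
Qed.

Lemma orbsize_ge1 x y : (1 <= orbsize x y)%E.
Proof.
have := @le_esum_term _ _ y (fun v => (orb2 x y x v)%:E).
by rewrite orb2_id; apply => v; rewrite lee_fin ?orb2_ge0 ?orb3_ge0.
Qed.

Lemma orbsize3_ge1 x y z : (1 <= orbsize3 x y z)%E.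
Proof.
have := @le_esum_term _ _ z (fun w => (orb3 x y z x y w)%:E).
by rewrite orb3_id; apply => w; rewrite lee_fin ?orb2_ge0 ?orb3_ge0.
Qed.

Lemma orbsize3_le x y z : (orbsize3 x y z <= orbsize x z)%E.
Proof. by apply: le_esum => w _; rewrite lee_fin orb3_le2. Qed.

Lemma orbsize3C x y z : orbsize3 x y z = orbsize3 y x z.
Proof. by apply: eq_esum => w _; rewrite orb3_perm12. Qed.

(** By the orbit-stabilizer theorem [orbsize x y] is the index of the joint stabilizer in the
    stabilizer of [x], so this says that the two stabilizers are commensurable. *)
Variant commens (x y : V) : Prop :=
  Commens of (orbsize x y < +oo)%E & (orbsize y x < +oo)%E.
(** An infinite orbit gets the value 0 here, hence the [commens] hypotheses below. *)
Definition osz x y : R := fine (orbsize x y).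
Definition osz3 x y z : R := fine (orbsize3 x y z).

Lemma commensC x y : commens x y -> commens y x. Proof. by case. Qed.

Lemma oszE x y : commens x y -> orbsize x y = (osz x y)%:E.
Proof.
move=> [xy _]; rewrite fineK// ge0_fin_numE//.
exact: le_trans (orbsize_ge1 x y).
Qed.

Lemma osz3E x y z : commens x z -> orbsize3 x y z = (osz3 x y z)%:E.
Proof.
move=> [xz _]; rewrite fineK// ge0_fin_numE; last exact: le_trans (orbsize3_ge1 x y z).
exact: le_lt_trans (orbsize3_le x y z) xz.
Qed.

Lemma osz_gt0 x y : commens x y -> 0 < osz x y.
Proof.
move=> xy; apply: (@lt_le_trans _ _ 1) => //.
by rewrite -lee_fin -oszE// orbsize_ge1.
Qed.

Lemma osz_ge1 x y : commens x y -> 1 <= osz x y.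
Proof. by move=> xy; rewrite -lee_fin -oszE// orbsize_ge1. Qed.

Lemma osz3_gt0 x y z : commens x z -> 0 < osz3 x y z.
Proof.
move=> xz; apply: (@lt_le_trans _ _ 1) => //.
by rewrite -lee_fin -osz3E// orbsize3_ge1.
Qed.

Lemma osz_move s x y : G s -> osz (s x) (s y) = osz x y.
Proof. by move=> Gs; rewrite /osz orbsize_move. Qed.

Lemma osz3C x y z : osz3 x y z = osz3 y x z.
Proof. by rewrite /osz3 orbsize3C. Qed.

(* Both sides count the orbit of the pair [(y, z)] under the stabilizer of [x]. *)
Lemma osz_mul x y z : commens x y -> commens x z ->
  osz x y * osz3 x y z = osz x z * osz3 x z y.
Proof.
move=> xy xz; apply: EFin_inj; rewrite !EFinM -(oszE xy) -(oszE xz).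
rewrite -(esum_orb2 x y x) -(esum_orb2 x z x).
rewrite -esumZr; [|exact/ltW/osz3_gt0|by move=> v; rewrite lee_fin].
rewrite -esumZr; [|exact/ltW/osz3_gt0|by move=> v; rewrite lee_fin].
transitivity (\esum_ v \esum_ w (orb3 x y z x v w)%:E).
  by apply: eq_esum => v _; rewrite esum_orb3 osz3E// muleC.
rewrite esum_exchange; last by move=> v w; rewrite lee_fin ?orb2_ge0 ?orb3_ge0.
apply: eq_esum => w _; rewrite muleC -osz3E// -esum_orb3; apply: eq_esum => v _.
by rewrite orb3_perm23.
Qed.

(** Three instances of [osz_mul], one based at each vertex, are multiplied; the triple factors [a],
    [b], [c] occur on both sides and cancel. *)
Lemma osz_cocycle x y z : commens x y -> commens y z -> commens x z ->
  osz x y * osz y z * osz z x = osz y x * osz z y * osz x z.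
Proof.
move=> xy yz xz.
have yx := commensC xy; have zy := commensC yz; have zx := commensC xz.
have E1 := osz_mul xy xz; have E2 := osz_mul yx yz; have E3 := osz_mul zx zy.
rewrite (osz3C y x) in E2; rewrite (osz3C z x) (osz3C z y) in E3.
have a0 := osz3_gt0 y xz; have b0 := osz3_gt0 z xy; have c0 := osz3_gt0 z yx.
set a := osz3 x y z in E1 E2 a0; set b := osz3 x z y in E1 E3 b0.
set c := osz3 y z x in E2 E3 c0.
apply: (@mulIf _ (a * b * c)); first by rewrite !mulf_neq0 ?gt_eqF.
transitivity ((osz x y * a) * (osz y z * c) * (osz z x * b)); first by ring.
by rewrite E1 -E2 E3; ring.
Qed.

(** * Averages over diagonal orbits *)

Section averaging.
Variables (F : V -> V -> R).
Hypothesis F0 : forall u v, 0 <= F u v.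

Definition orbsum x y : \bar R := \esum_ u \esum_ v (orb2 x y u v * F u v)%:E.
(** This is [q] of the outline, for a general nonnegative [F]. *)
Definition avg x y : \bar R := (orbsum x y * ((osz x y)^-1)%:E)%E.

Let oF0 x y u v : (0 <= (orb2 x y u v * F u v)%:E)%E.
Proof. by rewrite lee_fin mulr_ge0 ?orb2_ge0 ?orb3_ge0. Qed.

Lemma orbsum_ge0 x y : (0 <= orbsum x y)%E.
Proof. by do 2![apply: esum_ge0 => ? _]. Qed.

(** Each pair in the orbit of [(x, y)] extends to exactly [osz3 x y z] triples. *)
Lemma orbsum3 x y z : commens x z ->
  \esum_ u \esum_ v \esum_ w (orb3 x y z u v w * F u v)%:E =
  (orbsum x y * (osz3 x y z)%:E)%E.
Proof.
move=> xz; have c0 := ltW (osz3_gt0 y xz).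
rewrite -esumZr//; last by move=> u; exact: esum_ge0.
apply: eq_esum => u _; rewrite -esumZr//; apply: eq_esum => v _.
under eq_esum do rewrite EFinM.
rewrite esumZr//; last by move=> w; rewrite lee_fin ?orb2_ge0 ?orb3_ge0.
by rewrite esum_orb3 osz3E// -!EFinM; congr (_%:E); ring.
Qed.

(** The pointwise inequality is summed over the orbit of [(x, y, z)]. Each pair orbit is then
    counted with a multiplicity that equals [M] divided by its [osz], with the same [M] for all
    three; for [(y, z)] this uses [osz x y = osz y x]. *)
Lemma avg_triangle (al be : R) x y z : 0 <= al -> 0 <= be ->
  (forall u v w, F u w <= al * F u v + be * F v w) ->
  commens x y -> commens y z -> commens x z -> osz x y = osz y x ->
  (avg x z <= al%:E * avg x y + be%:E * avg y z)%E.
Proof.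
move=> al0 be0 HF xy yz xz sxy.
have yx := commensC xy; have zy := commensC yz; have zx := commensC xz.
pose S (H : V -> V -> V -> R) := \esum_ u \esum_ v \esum_ w (orb3 x y z u v w * H u v w)%:E.
have Exy : S (fun u v _ => F u v) = (orbsum x y * (osz3 x y z)%:E)%E by exact: orbsum3.
have Exz : S (fun u _ w => F u w) = (orbsum x z * (osz3 x z y)%:E)%E.
  rewrite -orbsum3//; apply: eq_esum => u _.
  rewrite esum_exchange => [|v w]; last by rewrite lee_fin mulr_ge0 ?orb2_ge0 ?orb3_ge0.
  by apply: eq_esum => w _; apply: eq_esum => v _; rewrite orb3_perm23.
have Eyz : S (fun _ v w => F v w) = (orbsum y z * (osz3 y z x)%:E)%E.
  rewrite -orbsum3// /S esum_exchange => [|u v]; last first.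
    by apply: esum_ge0 => w _; rewrite lee_fin mulr_ge0 ?orb3_ge0.
  apply: eq_esum => v _.
  rewrite esum_exchange => [|u w]; last by rewrite lee_fin mulr_ge0 ?orb2_ge0 ?orb3_ge0.
  apply: eq_esum => w _; apply: eq_esum => u _.
  by rewrite orb3_perm12 orb3_perm23.
have H0 (H : V -> V -> V -> R) u v w : (forall u v w, 0 <= H u v w) ->
    (0 <= (orb3 x y z u v w * H u v w)%:E)%E by move=> h; rewrite lee_fin mulr_ge0 ?orb3_ge0.
have main : (orbsum x z * (osz3 x z y)%:E <= al%:E * (orbsum x y * (osz3 x y z)%:E)
    + be%:E * (orbsum y z * (osz3 y z x)%:E))%E.
  rewrite -Exy -Exz -Eyz /S -esum_comb//; last 2 first.
  - by move=> u; do 2![apply: esum_ge0 => ? _]; exact: (H0 (fun u v _ => F u v)).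
  - by move=> u; do 2![apply: esum_ge0 => ? _]; exact: (H0 (fun _ v w => F v w)).
  apply: le_esum => u _; rewrite -esum_comb//; last 2 first.
  - by move=> v; apply: esum_ge0 => ? _; exact: (H0 (fun u v _ => F u v)).
  - by move=> v; apply: esum_ge0 => ? _; exact: (H0 (fun _ v w => F v w)).
  apply: le_esum => v _; rewrite -esum_comb//; last 2 first.
  - by move=> w; exact: (H0 (fun u v _ => F u v)).
  - by move=> w; exact: (H0 (fun _ v w => F v w)).
  apply: le_esum => w _; rewrite -!EFinM -EFinD lee_fin.
  by have := ler_wpM2l (orb3_ge0 x y z u v w) (HF u v w); lra.
have E1 := osz_mul xy xz; have E2 := osz_mul yx yz.
rewrite (osz3C y x) -sxy in E2.
pose M := osz x y * osz3 x y z.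
have M0 : 0 < M := mulr_gt0 (osz_gt0 xy) (osz3_gt0 y xz).
have split3 (a c : R) : 0 < c -> a * c = M -> a^-1 = c * M^-1.
  by move=> c0 <-; rewrite invfM mulrCA mulfV ?mulr1// gt_eqF.
rewrite /avg (split3 _ _ (osz3_gt0 z xy) (esym E1)).
rewrite (split3 _ _ (osz3_gt0 y xz) erefl) (split3 _ _ (osz3_gt0 z yx) (esym E2)).
rewrite !EFinM !muleA -muleDl//; last first.
  by apply: ge0_adde_def; rewrite inE !mule_ge0 ?orbsum_ge0// lee_fin ltW// osz3_gt0.
apply: lee_wpmul2r; first by rewrite lee_fin invr_ge0 ltW.
by rewrite -!muleA.
Qed.

Lemma avg_diag x : (forall u, F u u = 0) -> avg x x = 0%E.
Proof.
move=> Fd; rewrite /avg (_ : orbsum x x = 0%E) ?mul0e//.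
apply: esum1 => u _; apply: esum1 => v _; rewrite /orb2.
by case: asboolP => [[s _ [<- <-]]|_]; rewrite ?mul0r// Fd mulr0.
Qed.

Section kernel_average.
Variable Q : V -> V -> R.
Hypothesis Q0 : forall x y, 0 <= Q x y.
Hypothesis QG : forall s x y, G s -> Q (s x) (s y) = Q x y.
Hypothesis Qcomm : forall x y, 0 < Q x y -> commens x y.

(** [Q] is constant on the orbit of [(x, y)], so the left side is the part of the right side carried
    by that orbit. *)
Lemma avg_le x y : ((Q x y)%:E * orbsum x y <= \esum_ u \esum_ v (Q u v * F u v)%:E)%E.
Proof.
rewrite -esumZl//; last by move=> u; exact: esum_ge0.
apply: le_esum => u _; rewrite -esumZl//; apply: le_esum => v _.
rewrite -EFinM lee_fin mulrA ler_wpM2r// /orb2.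
case: asboolP => [[s Gs [<- <-]]|_]; first by rewrite QG// mulr1.
by rewrite mulr0.
Qed.

(** For fixed [(u, v)], the [y] such that [(x, y)] lies in the same diagonal orbit form one
    stabilizer orbit; its length cancels the normalisation of [avg]. *)
Lemma esum_ker_avg x :
  \esum_ y ((Q x y)%:E * avg x y) = \esum_ u \esum_ v (Q u v * F u v)%:E.
Proof.
have i0 y : 0 <= (osz x y)^-1.
  rewrite invr_ge0 /osz fine_ge0//; exact: le_trans (orbsize_ge1 x y).
have E y : ((Q x y)%:E * avg x y)%E =
    \esum_ u \esum_ v ((Q x y * (osz x y)^-1) * (orb2 x y u v * F u v))%:E.
  rewrite /avg (muleC (orbsum x y)) muleA -EFinM -esumZl ?mulr_ge0//; last first.
    by move=> u; exact: esum_ge0.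
  by apply: eq_esum => u _; rewrite -esumZl ?mulr_ge0.
rewrite (eq_esum (fun y _ => E y)) esum_exchange; last first.
  by move=> y u; apply: esum_ge0 => v _; rewrite lee_fin !mulr_ge0 ?orb2_ge0.
apply: eq_esum => u _.
rewrite esum_exchange; last by move=> y v; rewrite lee_fin !mulr_ge0 ?orb2_ge0.
apply: eq_esum => v _.
have [s Gs su] := Gtrans x u; have [s' [Gs' ss' s's]] := GV Gs.
pose y0 := s' v; have sy0 : s y0 = v by rewrite /y0 s's.
have Quv : Q u v = Q x y0 by rewrite -su -sy0 QG.
transitivity (\esum_ y ((orb2 x y0 x y)%:E * (Q x y0 * (osz x y0)^-1 * F u v)%:E)).
  apply: eq_esum => y _; rewrite -EFinM; congr (_%:E).
  rewrite -su -sy0 orb2_move// orb2_swap /orb2.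
  case: asboolP => [[r Gr [rx ry]]|_]; last by rewrite !mul0r mulr0.
  have -> : osz x y = osz x y0 by rewrite -{1}rx -ry osz_move.
  have -> : Q x y = Q x y0 by rewrite -{1}rx -ry QG.
  by ring.
rewrite esumZr ?mulr_ge0//; last by move=> y; rewrite lee_fin ?orb2_ge0 ?orb3_ge0.
rewrite esum_orb2 Quv.
(* Where [Q] vanishes the orbit may be infinite and nothing cancels, but both sides are 0. *)
have [Qz|Qp] := eqVneq (Q x y0) 0; first by rewrite Qz !mul0r mule0.
have xy0 : commens x y0 by apply: Qcomm; rewrite lt0r Qp Q0.
rewrite oszE// -EFinM; congr (_%:E).
by field; rewrite gt_eqF// osz_gt0.
Qed.

End kernel_average.
End averaging.

Lemma ker_comm (Q : V -> V -> R) x y : stochastic Q ->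
  (forall x y, Q x y = Q y x) ->
  (forall s x y, G s -> Q (s x) (s y) = Q x y) -> 0 < Q x y -> commens x y.
Proof.
move=> stoQ symQ QG.
suff fin a b : 0 < Q a b -> (orbsize a b < +oo)%E.
  by move=> xy; split; apply: fin => //; rewrite symQ.
move=> ab; have : ((Q a b)%:E * orbsize a b <= 1)%E.
  rewrite -(ker_sum1 stoQ a) -esumZl; [|exact: ltW|by move=> v; rewrite lee_fin orb2_ge0].
  apply: le_esum => v _.
  rewrite -EFinM lee_fin /orb2; case: asboolP => [[s Gs [sa sb]]|_].
    by rewrite mulr1 -{2}sa -sb QG.
  by rewrite mulr0 ker_ge0.
rewrite ltey; apply: contraTneq => ->.
by rewrite gt0_muley// leye_eq.
Qed.

Lemma ker_osz_le (Q : V -> V -> R) x y : stochastic Q ->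
  (forall s x y, G s -> Q (s x) (s y) = Q x y) -> commens x y -> Q x y * osz x y <= 1.
Proof.
move=> stoQ QG xy; rewrite -lee_fin EFinM -oszE// -(ker_sum1 stoQ x).
rewrite -esumZl; [|exact: ker_ge0|by move=> v; rewrite lee_fin orb2_ge0].
apply: le_esum => v _.
rewrite -EFinM lee_fin /orb2; case: asboolP => [[s Gs [sa sb]]|_].
  by rewrite mulr1 -{2}sa -sb QG.
by rewrite mulr0 ker_ge0.
Qed.

(** * Comparing the walk with the path metric *)

Section graph_walk.
Variable P : V -> V -> R.
Hypothesis symP : forall x y, P x y = P y x.
Hypothesis stoP : stochastic P.
Hypothesis PG : forall s x y, G s -> P (s x) (s y) = P x y.
Variables (E : rel V) (p : R).
Hypothesis symE : symmetric E.
Hypothesis p_gt0 : 0 < p.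
Hypothesis P_edge : forall x y, E x y -> p <= P x y.

Lemma kpow_move n s x y : G s -> kpow P n (s x) (s y) = kpow P n x y.
Proof. by move=> Gs; apply: kpow_invariant => //; [exact: G_bij|move=> ? ?; exact: PG]. Qed.

Lemma kpow_comm n x y : 0 < kpow P n x y -> commens x y.
Proof.
apply: ker_comm; [exact: kpow_stochastic|exact: kpow_sym|].
by move=> ? ? ? Gs; exact: kpow_move.
Qed.

Lemma P_comm x y : 0 < P x y -> commens x y.
Proof. by rewrite -(kpow1 symP stoP); exact: kpow_comm. Qed.

Lemma edge_gt0 x y : E x y -> 0 < P x y.
Proof. by move=> /P_edge; exact: lt_le_trans. Qed.

Lemma kpow_step n x y z : 0 < kpow P n x y -> 0 < P y z -> 0 < kpow P n.+1 x z.
Proof.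
move=> xy yz; rewrite -lte_fin kpowSr//.
apply: (@lt_le_trans _ _ ((kpow P n x y)%:E * (P y z)%:E)%E).
  by rewrite mule_gt0 ?lte_fin.
apply: (@le_esum_term _ _ y (fun w => (kpow P n x w)%:E * (P w z)%:E)%E) => w.
by rewrite mule_ge0 ?lee_fin ?(ker_ge0 stoP)// (kpow_ge0 symP stoP).
Qed.

Lemma kpow_stepl n x y z : 0 < P x y -> 0 < kpow P n y z -> 0 < kpow P n.+1 x z.
Proof.
move=> xy yz; rewrite (kpow_sym symP stoP); apply: (@kpow_step _ _ y); last by rewrite symP.
by rewrite (kpow_sym symP stoP).
Qed.

(** Edges have positive transition probability, so the walk can follow the path; this supplies
    commensurability at every step. *)
Lemma path_induction (x : V) (H : nat -> V -> Prop) : H 0%N x ->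
  (forall n y z, 0 < kpow P n x y -> commens x y -> commens y z -> commens x z -> E y z ->
     H n y -> H n.+1 z) ->
  forall s, path E x s -> H (size s) (last x s).
Proof.
move=> H0 HS s ps; suff [] : H (size s) (last x s) /\ 0 < kpow P (size s) x (last x s) by [].
elim/last_ind: s ps => [|s z IH]; first by rewrite kpow0 eqxx ltr01.
rewrite rcons_path size_rcons last_rcons => /andP[ps Ez].
have [Hs ks] := IH ps; have Pz := edge_gt0 Ez; have kz := kpow_step ks Pz.
split=> //; apply: HS Hs => //; [exact: kpow_comm ks|exact: P_comm|exact: kpow_comm kz].
Qed.

Lemma gdist_ge0 (x y : V) : (0 <= gdist R E x y)%E.
Proof. by apply: le_ereal_inf_tmp => _ [s _ <-]; rewrite lee_fin. Qed.

(** Path lengths are natural numbers, so the distance is attained if a path exists; otherwise the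
    right side is [+oo], since [L > 0]. *)
Lemma gdist_bound (x y : V) (f : \bar R) (L : R) : 0 < L ->
  (forall s, path E x s -> last x s = y -> (f <= ((size s)%:R ^+ 2 * L)%:E)%E) ->
  (f <= L%:E * gdist R E x y ^+ 2)%E.
Proof.
move=> L0 fL.
pose D := [pred n | `[< exists2 s, path E x s /\ last x s = y & size s = n >]].
have [exD|noD] := pselect (exists n, D n).
  have [m /asboolP[s [ps sy] sm] mmin] := ex_minnP exD.
  suff -> : gdist R E x y = (m%:R)%:E by rewrite -EFin_expe -EFinM mulrC -sm fL.
  apply/eqP; rewrite eq_le; apply/andP; split.
    by apply: ereal_inf_lbound; exists s => //; rewrite sm.
  apply: le_ereal_inf_tmp => _ [r [pr ry] <-]; rewrite lee_fin ler_nat.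
  by apply: mmin; apply/asboolP; exists r.
suff -> : gdist R E x y = +oo%E by rewrite expe2 mulyy gt0_muley ?leey// lte_fin.
rewrite /gdist (_ : mkset _ = set0) ?image_set0 ?ereal_inf0//.
apply/seteqP; split=> // s [ps sy]; apply: noD; exists (size s).
by apply/asboolP; exists s.
Qed.

Definition msd t x : \bar R := \esum_ y ((kpow P t x y)%:E * gdist R E x y ^+ 2).

(** * Equal orbit sizes across every edge *)

Section symmetric_orbits.
Hypothesis sym_osz : forall x y, E x y -> osz x y = osz y x.
Variable psi : V -> R.
Hypothesis lpsi : in_l2 psi.
Hypothesis dpsi : 0 < dirichlet P psi 1.

Let F u v := (psi u - psi v) ^+ 2.
Let F0 u v : 0 <= F u v. Proof. exact: sqr_ge0. Qed.
Let L := 2 * dirichlet P psi 1 / p.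

Let L_gt0 : 0 < L. Proof. by rewrite divr_gt0 ?mulr_gt0. Qed.

Lemma avg_edge x y : E x y -> (avg F x y <= L%:E)%E.
Proof.
move=> Exy; have xy := P_comm (edge_gt0 Exy).
have := avg_le F0 (ker_ge0 stoP) PG x y.
under [X in (_ <= X)%E -> _]eq_esum do under eq_esum do rewrite -(kpow1 symP stoP).
rewrite -(dirichlet_esum symP stoP lpsi 1) => B.
apply: (@le_trans _ _ (orbsum F x y * 1%:E)%E).
  apply: lee_wpmul2l; first exact: orbsum_ge0.
  by rewrite lee_fin invf_le1 ?osz_ge1 ?osz_gt0.
rewrite mule1 /L mulrC EFinM lee_pdivlMl//; apply: le_trans B.
apply: lee_wpmul2r; first exact: orbsum_ge0.
by rewrite lee_fin P_edge.
Qed.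

Lemma avg_path x s : path E x s ->
  (avg F x (last x s) <= ((size s)%:R ^+ 2 * L)%:E)%E.
Proof.
(* [avg_triangle] needs the orbit sizes between [x] and [y] to agree, which the cocycle identity
   propagates along the path; the middle clause serves the first edge, where [1/n] has no
   meaning. *)
move=> ps; pose H n y := [/\ osz x y = osz y x, n = 0%N -> y = x
  & (avg F x y <= (n%:R ^+ 2 * L)%:E)%E].
suff [] : H (size s) (last x s) by [].
apply: (@path_induction x H) ps.
  split=> //; rewrite avg_diag => [|u]; last by rewrite /F subrr expr0n.
  by rewrite lee_fin mulr_ge0 ?sqr_ge0// ltW.
move=> n y z _ xy yz xz Ez [sy y0 Ay]; split=> //.
  have := osz_cocycle xy yz xz; rewrite sy (sym_osz Ez).
  have n0 : osz y x * osz z y != 0.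
    by rewrite mulf_neq0 ?gt_eqF ?osz_gt0//; exact: commensC.
  by move/(mulfI n0).
have An := avg_edge Ez.
have [n0|n_gt0] := posnP n.
  by move: An; rewrite n0 expr1n mul1r y0.
have nr : 0 < n%:R :> R by rewrite ltr0n.
(* The weights [1 + 1/n] and [1 + n] lose nothing for lengths [n] and 1:
   [(1 + 1/n) n^2 + (1 + n) = (n + 1)^2]. *)
have al0 : 0 <= 1 + n%:R^-1 :> R by rewrite addr_ge0 ?invr_ge0 ?ler0n.
have be0 : 0 <= 1 + n%:R :> R by rewrite addr_ge0 ?ler0n.
apply: le_trans (avg_triangle F0 al0 be0 _ xy yz xz sy) _.
  move=> u v w; rewrite -subr_ge0 /F.
  have -> : (1 + n%:R^-1) * (psi u - psi v) ^+ 2 + (1 + n%:R) * (psi v - psi w) ^+ 2 -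
      (psi u - psi w) ^+ 2 = n%:R^-1 * ((psi u - psi v) - n%:R * (psi v - psi w)) ^+ 2.
    by field; rewrite gt_eqF.
  by rewrite mulr_ge0 ?sqr_ge0 ?invr_ge0 ?ler0n.
apply: (@le_trans _ _ ((1 + n%:R^-1)%:E * (n%:R ^+ 2 * L)%:E + (1 + n%:R)%:E * L%:E)%E).
  by apply: leeD; apply: lee_wpmul2l; rewrite ?lee_fin.
rewrite -!EFinM -EFinD lee_fin -(natr1 n) le_eqVlt; apply/orP; left; apply/eqP.
by field; rewrite gt_eqF.
Qed.

Lemma msd_symmetric t x : ((p * (dirichlet P psi t / dirichlet P psi 1))%:E <= msd t x)%E.
Proof.
have -> : p * (dirichlet P psi t / dirichlet P psi 1) = L^-1 * (2 * dirichlet P psi t).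
  by rewrite /L; field; rewrite !gt_eqF.
rewrite EFinM lee_pdivrMl// (dirichlet_esum symP stoP lpsi).
rewrite -(esum_ker_avg F0 _ _ (@kpow_comm t) x); [|exact: kpow_ge0|by move=> *; exact: kpow_move].
rewrite /msd -(esumZl (ltW L_gt0)) => [|y]; last first.
  by rewrite mule_ge0 ?lee_fin ?(kpow_ge0 symP stoP)// expe_ge0 ?gdist_ge0.
apply: le_esum => y _; rewrite [leRHS]muleCA; apply: lee_wpmul2l.
  by rewrite lee_fin (kpow_ge0 symP stoP).
by apply: gdist_bound => // s ps <-; exact: avg_path.
Qed.

End symmetric_orbits.

(** * Unequal orbit sizes across some edge *)

Section asymmetric_orbits.
Variables (a b : V).
Hypothesis Eab : E a b.
Hypothesis asym : osz a b != osz b a.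

Definition height x y : R := ln (osz x y) - ln (osz y x).

Lemma heightC x y : height y x = - height x y.
Proof. by rewrite opprB. Qed.

Lemma height_move s x y : G s -> height (s x) (s y) = height x y.
Proof. by move=> Gs; rewrite /height !osz_move. Qed.

Lemma height_cocycle x y z : commens x y -> commens y z -> commens x z ->
  height x z = height x y + height y z.
Proof.
move=> xy yz xz; have yx := commensC xy; have zy := commensC yz; have zx := commensC xz.
have := congr1 (@ln R) (osz_cocycle xy yz xz).
rewrite !lnM ?posrE ?mulr_gt0 ?osz_gt0// /height; lra.
Qed.

(** Both orbit sizes of an edge lie between 1 and [1/p], as a row of [P] sums to 1. This makes the
    supremum [l] finite. *)
Lemma height_edge x y : E x y -> `|height x y| <= ln p^-1.
Proof.
have le u v : E u v -> ln (osz u v) <= ln p^-1 /\ 0 <= ln (osz u v).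
  move=> Euv; have uv := P_comm (edge_gt0 Euv); have o0 := osz_gt0 uv.
  split; last by rewrite ln_ge0// osz_ge1.
  rewrite ler_ln ?posrE ?invr_gt0// -[p^-1]mul1r ler_pdivlMr//.
  apply: le_trans (ker_osz_le stoP PG uv); rewrite mulrC.
  by rewrite ler_wpM2r ?P_edge// ltW.
move=> Exy; have [h1 h2] := le _ _ Exy; have := le y x; rewrite symE => /(_ Exy)[h3 h4].
by rewrite ler_norml /height; apply/andP; split; lra.
Qed.

Let S := [set `|height e.1 e.2| | e in [set e : V * V | E e.1 e.2]].
Let l := sup S.

Let has_supS : has_sup S.
Proof.
split; first by exists `|height a b|; exists (a, b).
by exists (ln p^-1) => _ [[x y] /= Exy <-]; exact: height_edge.
Qed.

Let height_le x y : E x y -> `|height x y| <= l.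
Proof. by move=> Exy; apply: ub_le_sup; [case: has_supS|exists (x, y)]. Qed.

Let l_gt0 : 0 < l.
Proof.
apply: lt_le_trans (height_le Eab); rewrite normr_gt0 subr_eq0.
have ab := P_comm (edge_gt0 Eab).
apply: contra asym => /eqP/ln_inj ->//; rewrite posrE osz_gt0//; exact: commensC.
Qed.

(** An edge within [l / 4] of the supremum; reversing it if necessary makes its height positive. *)
Let steep : exists x y, E x y /\ 3 / 4 * l <= height x y.
Proof.
have [_ [[x y] /= Exy <-]] := sup_adherent (divr_gt0 l_gt0 (ltr0n R 4)) has_supS.
rewrite -/l => lh; have {lh} : 3 / 4 * l <= `|height x y| by lra.
have [h0|h0] := leP 0 (height x y).
  by rewrite ger0_norm// => ?; exists x, y.
by rewrite ltr0_norm// -heightC => ?; exists y, x; rewrite symE.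
Qed.

Let moment t x c : \bar R := \esum_ z (kpow P t x z * (c + height x z) ^+ 2)%:E.

Let moment_move s t x c : G s -> moment t (s x) c = moment t x c.
Proof.
move=> Gs; rewrite /moment -(esum_reindex _ (G_bij Gs)); apply: eq_esum => z _.
by rewrite kpow_move// height_move.
Qed.

(* [9 / 8 = 2 * (3 / 4) ^ 2]: the two opposite steps leave room for an edge
   that only nearly attains the supremum [l]. *)
Let k := 9 / 8 * (p * l ^+ 2).

(** If the height of one step has mean [mu], its moment about the shift [c] is its variance plus
    [(c + mu)^2]. Hence [m = - mu], and it remains to bound the variance, the moment at shift
    [- mu], by [k]. *)
Let moment1_lower : exists m, forall x c, ((k + (c - m) ^+ 2)%:E <= moment 1 x c)%E.
Proof.
suff [m H] : exists m, forall c, ((k + (c - m) ^+ 2)%:E <= moment 1 a c)%E.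
  by exists m => x c; have [s Gs <-] := Gtrans a x; rewrite moment_move.
have w0 c z : 0 <= P a z * (c + height a z) ^+ 2.
  by rewrite mulr_ge0 ?sqr_ge0// (ker_ge0 stoP).
have ME c : moment 1 a c = \esum_ z (P a z * (c + height a z) ^+ 2)%:E.
  by apply: eq_esum => z _; rewrite kpow1.
(* If all shifted moments are infinite, any [m] will do; if a single one is finite, so are the first
   two moments of the height. *)
have [[c fin]|inf] := pselect (exists c, moment 1 a c < +oo)%E; last first.
  exists 0 => c; suff -> : moment 1 a c = +oo%E by rewrite leey.
  by apply/eqP; rewrite -leye_eq leNgt; apply/negP => fc; apply: inf; exists c.
have s2 : summ (fun z => P a z * height a z ^+ 2).
  have sc : summ (fun z => P a z * (c + height a z) ^+ 2) by rewrite summE// -ME.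
  apply: summ_le (summD (summZ 2 sc) (summZ (2 * c ^+ 2) (ker_summ stoP a))) _ => z.
  rewrite ger0_norm ?(ker_sqr_ge0 stoP)//.
  have := ker_ge0 stoP a z; have := sqr_ge0 (2 * c + height a z).
  by move=> q0 P0; have := mulr_ge0 P0 q0; lra.
have s1 : summ (fun z => P a z * height a z).
  apply: summ_le (summD s2 (ker_summ stoP a)) _ => z.
  have P0 := ker_ge0 stoP a z; rewrite normrM (ger0_norm P0).
  rewrite -[X in _ + X]mulr1 -mulrDr ler_wpM2l// ler_norml; apply/andP; split; nra.
pose mu := rsum (fun z => P a z * height a z).
pose nu := rsum (fun z => P a z * height a z ^+ 2).
have M1 e : moment 1 a e = (e ^+ 2 + 2 * e * mu + nu)%:E.
  have -> : moment 1 a e = \esum_ z (e ^+ 2 * P a z + (2 * e) * (P a z * height a z)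
      + P a z * height a z ^+ 2)%:E.
    by rewrite ME; apply: eq_esum => z _; congr (_%:E); ring.
  have sA := summZ (e ^+ 2) (ker_summ stoP a); have sB := summZ (2 * e) s1.
  rewrite -rsum_ge0E.
  - rewrite rsumD//; last exact: summD.
    by rewrite rsumD// !rsumZ ?rsum_ker ?mulr1//; exact: ker_summ.
  - move=> z; have := w0 e z; lra.
  - by apply: summD => //; exact: summD.
exists (- mu) => e.
suff : k <= nu - mu ^+ 2 by rewrite M1 lee_fin; lra.
suff : (k%:E <= moment 1 a (- mu))%E by rewrite M1 lee_fin; lra.
(* The steep edge and its reverse are both moved to start at [a], which gives two steps from [a]
   with opposite heights. *)
have [x [y [Exy hxy]]] := steep.
have [s Gs sx] := Gtrans x a; have [s' Gs' sy] := Gtrans y a.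
have h1 : 3 / 4 * l <= height a (s y) by rewrite -sx height_move.
have h2 : height a (s' x) <= - (3 / 4 * l) by rewrite -sy height_move// heightC lerN2.
have P1 : p <= P a (s y) by rewrite -sx PG// P_edge.
have P2 : p <= P a (s' x) by rewrite -sy PG// P_edge// symE.
have ne : s y != s' x by apply/eqP => e2; move: h1 h2; rewrite e2; have := l_gt0; lra.
rewrite ME; apply: le_trans (le_esum_two ne _) => [|z]; last by rewrite lee_fin.
rewrite -EFinD lee_fin /k.
(* Two squares add up to at least half the square of the difference of their bases, here
   [C - D >= 3 / 2 * l], whatever the shift [r]. *)
have step (A B C D r : R) : p <= A -> p <= B -> 3 / 4 * l <= C -> D <= - (3 / 4 * l) ->
    9 / 8 * (p * l ^+ 2) <= A * (r + C) ^+ 2 + B * (r + D) ^+ 2.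
  move=> pA pB lC lD.
  have l0 := l_gt0; have p0 := p_gt0.
  have e1 : p * (r + C) ^+ 2 <= A * (r + C) ^+ 2 by rewrite ler_wpM2r ?sqr_ge0.
  have e3 : p * (r + D) ^+ 2 <= B * (r + D) ^+ 2 by rewrite ler_wpM2r ?sqr_ge0.
  suff : p * (9 / 8 * l ^+ 2) <= p * ((r + C) ^+ 2 + (r + D) ^+ 2) by lra.
  rewrite ler_wpM2l ?(ltW p0)//.
  have e4 : 0 <= (2 * r + C + D) ^+ 2 by exact: sqr_ge0.
  have e5 : (3 / 2 * l) ^+ 2 <= (C - D) ^+ 2 by rewrite ler_sqr ?nnegrE; lra.
  have -> : (r + C) ^+ 2 + (r + D) ^+ 2 = ((2 * r + C + D) ^+ 2 + (C - D) ^+ 2) / 2.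
    by field.
  have e6 : (3 / 2 * l) ^+ 2 = 9 / 4 * l ^+ 2 by field.
  by rewrite e6 in e5; lra.
exact: step.
Qed.

(* Quantifying over all shifts [c] makes the induction work without assuming
   that the height has a finite second moment. *)
Let moment_lower t : exists m, forall x c, ((t%:R * k + (c - m) ^+ 2)%:E <= moment t x c)%E.
Proof.
have [m1 H1] := moment1_lower.
elim: t => [|t [m H]].
  exists 0 => x c; rewrite mul0r add0r subr0.
  apply: le_trans (@le_esum_term _ _ x (fun z => (kpow P 0 x z * (c + height x z) ^+ 2)%:E) _).
    by rewrite kpow0 eqxx mul1r /height subrr addr0.
  by move=> z; rewrite lee_fin mulr_ge0 ?sqr_ge0 ?(kpow_ge0 symP stoP).
exists (m + m1) => x c.
have K0 n u v : 0 <= kpow P n u v by exact: kpow_ge0.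
have P0 := ker_ge0 stoP.
have -> : moment t.+1 x c = \esum_ y ((P x y)%:E * moment t y (c + height x y)).
  have E1 z : (kpow P t.+1 x z * (c + height x z) ^+ 2)%:E =
      \esum_ y (P x y * (kpow P t y z * (c + height x y + height y z) ^+ 2))%:E.
    rewrite EFinM kpowS// -esumZr ?sqr_ge0//; last first.
      by move=> y; rewrite mule_ge0 ?lee_fin.
    apply: eq_esum => y _; rewrite -!EFinM; congr (_%:E).
    (* The cocycle identity needs commensurability, which is available when both weights are
       positive; the remaining terms vanish. *)
    have [Pz|Pn] := eqVneq (P x y) 0; first by rewrite Pz !mul0r.
    have [Kz|Kn] := eqVneq (kpow P t y z) 0; first by rewrite Kz !(mul0r, mulr0).
    have Pp : 0 < P x y by rewrite lt0r Pn P0.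
    have Kp : 0 < kpow P t y z by rewrite lt0r Kn K0.
    rewrite (height_cocycle (P_comm Pp) (kpow_comm Kp) (kpow_comm (kpow_stepl Pp Kp))).
    by rewrite addrA mulrA.
  rewrite /moment (eq_esum (fun z _ => E1 z)) esum_exchange; last first.
    by move=> z y; rewrite lee_fin mulr_ge0// mulr_ge0// sqr_ge0.
  apply: eq_esum => y _; rewrite -esumZl// => z.
  by rewrite lee_fin mulr_ge0 ?sqr_ge0.
(* Induction at [y] with shift [c + height x y] leaves the square of [(c - m) + height x y]; its
   average is a one-step moment with shift [c - m], so the new centre is [m + m1]. *)
apply: (@le_trans _ _ (\esum_ y ((t%:R * k)%:E * (P x y)%:E
    + 1%:E * (P x y * ((c - m) + height x y) ^+ 2)%:E)%E)).
  rewrite esum_comb//; last 3 first.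
  - by rewrite mulr_ge0// mulr_ge0// mulr_ge0 ?sqr_ge0// ltW.
  - by move=> y; rewrite lee_fin.
  - by move=> y; rewrite lee_fin mulr_ge0 ?sqr_ge0.
  rewrite (ker_sum1 stoP) mule1 mul1e.
  have := H1 x (c - m); rewrite /moment => H1x.
  under eq_esum do rewrite -(kpow1 symP stoP).
  apply: le_trans (leeD2l _ H1x); rewrite -EFinD lee_fin -(natr1 t); lra.
apply: le_esum => y _; rewrite mul1e -EFinM -EFinD.
apply: (@le_trans _ _ ((P x y)%:E * (t%:R * k + (c + height x y - m) ^+ 2)%:E)%E).
  by rewrite -EFinM lee_fin; lra.
by apply: lee_wpmul2l; rewrite ?lee_fin.
Qed.

Lemma msd_asymmetric t x : ((t%:R * p)%:E <= msd t x)%E.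
Proof.
have [m /(_ x 0) H] := moment_lower t.
have l2 : 0 < l ^+ 2 by rewrite exprn_gt0.
have : (((l ^+ 2) * (t%:R * p))%:E <= moment t x 0)%E.
  apply: le_trans H; rewrite lee_fin /k.
  have t0 : 0 <= t%:R * (p * l ^+ 2) by rewrite mulr_ge0// mulr_ge0 ?sqr_ge0// ltW.
  by have := sqr_ge0 (0 - m); lra.
move=> B; rewrite -(@lee_pmul2l _ (l ^+ 2)%:E) ?lte_fin//.
rewrite -EFinM; apply: le_trans B _.
rewrite /msd -(esumZl (ltW l2)) => [|y]; last first.
  by rewrite mule_ge0 ?lee_fin ?(kpow_ge0 symP stoP)// expe_ge0 ?gdist_ge0.
apply: le_esum => y _; rewrite add0r EFinM [leRHS]muleCA; apply: lee_wpmul2l.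
  by rewrite lee_fin (kpow_ge0 symP stoP).
apply: gdist_bound => // s ps <-; rewrite lee_fin -exprMn -real_normK ?num_real//.
rewrite ler_sqr ?nnegrE ?mulr_ge0 ?ler0n ?(ltW l_gt0)//.
apply: (@path_induction x (fun n y => `|height x y| <= n%:R * l)) ps.
  by rewrite /height subrr normr0 mul0r.
move=> n y' z _ xy yz xz Ez IH; rewrite (height_cocycle xy yz xz).
apply: le_trans (ler_normD _ _) _; rewrite -natr1 mulrDl mul1r lerD//.
exact: height_le.
Qed.

End asymmetric_orbits.

Lemma msd_lower (psi : V -> R) t x : in_l2 psi -> 0 < dirichlet P psi 1 ->
  ((p * (dirichlet P psi t / dirichlet P psi 1))%:E <= msd t x)%E.
Proof.
move=> lpsi d1.
have [sym|asym] := pselect (forall x y, E x y -> osz x y = osz y x).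
  exact: msd_symmetric.
have [a [b [Eab ab]]] : exists a b, E a b /\ osz a b != osz b a.
  apply: contra_notP asym => no u v Euv; apply/eqP; apply: contra_notT no => uv.
  by exists u, v.
apply: le_trans (msd_asymmetric Eab ab t x).
rewrite lee_fin mulrC ler_wpM2r ?(ltW p_gt0)// ler_pdivrMr//.
exact: dirichlet_upper.
Qed.

End graph_walk.
End orbits.

(** * Proof of the theorem *)

Section automorphism_group.
Context {R : realType} {V : countType} {P : V -> V -> R}.
Variable Gamma : groupClosed (Aut P).

(** The subgroup as a set of plain maps, the form in which the orbit arguments take it. *)
Definition aut_set : set (V -> V) := [set (s : V -> V) | s in [set s : Aut P | s \in Gamma]].

Lemma aut_set1 : aut_set id.
Proof. by exists 1%g => //; exact: gpred1. Qed.

Lemma aut_setM s u : aut_set s -> aut_set u -> aut_set (s \o u).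
Proof. by move=> [s' sG <-] [u' uG <-]; exists (s' * u')%g => //; exact: gpredM. Qed.

Lemma aut_setV s : aut_set s -> exists u, [/\ aut_set u, cancel s u & cancel u s].
Proof.
move=> [s' sG <-]; exists (s'^-1)%g; split.
- by exists (s'^-1)%g => //; exact: gpredVr.
- by move=> x; have := congr1 (fun u : Aut P => u x) (mulVg s').
- by move=> x; have := congr1 (fun u : Aut P => u x) (mulgV s').
Qed.

End automorphism_group.

(** Without edges [pstar] is an infimum over the empty set, namely [+oo], so the theorem can demand
    an infinite expectation; distinct vertices are then at distance [+oo]. *)
Lemma msd_infinite (R : realType) (V : countType) (P : V -> V -> R)
    (symP : forall x y, P x y = P y x) (stoP : stochastic P) (E : rel V) t (x y : V) :
  (forall u v, ~ E u v) -> y <> x -> 0 < kpow P t x y -> msd P E t x = +oo%E.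
Proof.
move=> noE yx Kxy; apply/eqP; rewrite -leye_eq.
have <- : ((kpow P t x y)%:E * gdist R E x y ^+ 2 = +oo)%E.
  rewrite /gdist (_ : mkset _ = set0); last first.
    apply/seteqP; split=> // -[|z s] /= [ps sy]; first by apply: yx.
    by move: ps => /andP[/noE].
  by rewrite image_set0 ereal_inf0 expe2 mulyy gt0_muley// lte_fin.
apply: (@le_esum_term _ _ y (fun z => (kpow P t x z)%:E * gdist R E x z ^+ 2)%E) => z.
by rewrite mule_ge0 ?lee_fin ?(kpow_ge0 symP stoP)// expe_ge0 ?gdist_ge0.
Qed.

Theorem theorem2p1 (R : realType) (V : countType) (P : V -> V -> R)
    (symP : forall x y, P x y = P y x) (stoP : stochastic P)
    (Gamma : groupClosed (Aut P))
    (closed_Gamma : closed [set s : Aut P | s \in Gamma])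
    (unimod_Gamma : unimodular R (subgroup Gamma))
    (trans_Gamma : forall x y : V, exists2 s : Aut P, s \in Gamma & s x = y)
    (E : rel V) (symE : symmetric E)
    (actE : forall s : Aut P, s \in Gamma -> forall x y, E (s x) (s y) = E x y)
    (psi : V -> R) (psi_l2 : in_l2 psi)
    (psi_nz : l2dot psi (psi \- markov_op P psi) != 0)
    (x0 : V) (d : measure_display) (Omega : measurableType d)
    (Pr : probability Omega R) (X : nat -> Omega -> V)
    (walkX : random_walk P x0 Pr X) (t : nat) :
  (\int[Pr]_w (gdist R E (X 0%N w) (X t w) ^+ 2) >=
     pstar E P *
       (l2dot psi (psi \- iter t (markov_op P) psi)
          / l2dot psi (psi \- markov_op P psi))%:E)%E /\
  (pstar E P *
     (l2dot psi (psi \- iter t (markov_op P) psi)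
        / l2dot psi (psi \- markov_op P psi))%:E >=
     pstar E P *
       (t%:R - t%:R ^+ 2 * (l2norm (psi \- markov_op P psi) ^+ 2
                / (2 * l2dot psi (psi \- markov_op P psi))))%:E)%E.
Proof.
have -> : l2dot psi (psi \- markov_op P psi) = dirichlet P psi 1 by [].
have -> : l2dot psi (psi \- iter t (markov_op P) psi) = dirichlet P psi t by [].
have d1 : 0 < dirichlet P psi 1 by rewrite lt0r psi_nz dirichlet_ge0.
have p0 : (0 <= pstar E P)%E.
  by apply: le_ereal_inf_tmp => _ [[x y] _ <-]; rewrite lee_fin (ker_ge0 stoP).
split; last first.
  apply: lee_wpmul2l => //; rewrite lee_fin ler_pdivlMr//.
  apply: le_trans (dirichlet_lower symP stoP psi_l2 t).
  rewrite le_eqVlt; apply/orP; left; apply/eqP; field; exact: lt0r_neq0.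
have F0 (x y : V) : (0 <= gdist R E x y ^+ 2)%E by rewrite expe_ge0 ?gdist_ge0.
apply: le_trans (walk_expectation symP stoP walkX t F0); rewrite -/(msd P E t x0).
pose G := aut_set Gamma.
have Gtrans x y : exists2 s, G s & s x = y.
  by have [s sG sxy] := trans_Gamma x y; exists s => //; exists s.
have PG s x y : G s -> P (s x) (s y) = P x y by move=> [s' _ <-]; exact: aut_P.
have [[e Ee]|noE] := pselect (exists e : V * V, E e.1 e.2).
  have pe : (pstar E P <= (P e.1 e.2)%:E)%E by apply: ereal_inf_lbound; exists e.
  have pfin : pstar E P = (fine (pstar E P))%:E.
    by rewrite fineK// ge0_fin_numE// (le_lt_trans pe)// ltry.
  (* With [pstar] equal to 0 the claimed bound is 0; otherwise [pstar] is a positive real and serves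
     as [p]. *)
  have [pz|pn] := eqVneq (pstar E P) 0%E.
    rewrite pz mul0e; apply: esum_ge0 => y _.
    by rewrite mule_ge0// lee_fin (kpow_ge0 symP stoP).
  have p_gt0 : 0 < fine (pstar E P) by rewrite -lte_fin -pfin lt0e pn.
  have P_edge x y : E x y -> fine (pstar E P) <= P x y.
    by move=> Exy; rewrite -lee_fin -pfin; apply: ereal_inf_lbound; exists (x, y).
  rewrite pfin -EFinM.
  exact: (msd_lower (aut_set1 Gamma) (@aut_setM _ _ _ Gamma) (@aut_setV _ _ _ Gamma) Gtrans
    symP stoP PG symE p_gt0 P_edge).
have noE' u v : ~ E u v by move=> Euv; apply: noE; exists (u, v).
(* Here [pstar] is [+oo], and [+oo * 0] is 0 by convention. *)
have [d0|dn] := eqVneq (dirichlet P psi t) 0.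
  rewrite d0 mul0r mule0; apply: esum_ge0 => y _.
  by rewrite mule_ge0// lee_fin (kpow_ge0 symP stoP).
(* If [kpow P t] had no mass off the diagonal in row [x0], then by transitivity it would have none
   in any row, and the double sum for [dirichlet P psi t] would vanish. *)
have [y yx Ky] : exists2 y, y <> x0 & 0 < kpow P t x0 y.
  apply: contrapT => no; move/eqP: dn; apply.
  apply: (@mulfI _ 2); rewrite ?pnatr_eq0// mulr0; apply: EFin_inj.
  rewrite dirichlet_esum//; apply: esum1 => u _; apply: esum1 => v _.
  have [->|uv] := eqVneq u v; first by rewrite subrr expr0n/= mulr0.
  have [->|Kuv] := eqVneq (kpow P t u v) 0; first by rewrite mul0r.
  exfalso; apply: no; have [s Gs su] := Gtrans u x0.
  have sinj : bijective s.
    by have [s' [_ ss' s's]] := aut_setV Gs; exists s'.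
  exists (s v); first by rewrite -su => /(bij_inj sinj)/eqP; rewrite eq_sym (negbTE uv).
  rewrite -su (kpow_invariant symP stoP _ sinj) ?lt0r ?Kuv ?kpow_ge0// => x y.
  exact: PG.
by rewrite (msd_infinite symP stoP noE' yx Ky) leey.
Qed.
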